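(* Let $\mathcal{L}$ be a Lindblad generator on an $N$-dimensional Hilbert space ($N\ge2$) satisfying the assumptions of the context, with steady state $\pi=\sum_n\pi_n|n\rangle\langle n|$, and let $A=\sum_n a_n|n\rangle\langle n|$, $B=\sum_n b_n|n\rangle\langle n|$ with $a_n,b_n\in\mathbb{R}$. Then for every $\tau\ge 0$, $$|\delta C_{ba}^\tau|\le\tau e^{-g\tau}\left[\mathcal{C}+\|A\|_*\|B\|_*\,\frac{\sigma}{\Phi\!\left(\frac{\sigma}{2\gamma}\right)}\right],$$ where $$\mathcal{C}:=\Theta\int_0^1 ds\,\Big[\|B\|_*\,C_{\ell_1}(A_{(1-s)\tau})+\|A\|_*\,C_{\ell_1}(B_{s\tau})\Big],\qquad \Theta:=4\|H\|_\infty+3\sum_k\|L_k\|_\infty^2 .$$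
   Context: Dynamics. The density matrix evolves by $\dot\varrho_t=\mathcal{L}(\varrho_t)$, $\mathcal{L}(\varrho):=-i[H,\varrho]+\sum_k\big(L_k\varrho L_k^\dagger-\tfrac12\{L_k^\dagger L_k,\varrho\}\big)$, with $H$ a time-independent Hermitian Hamiltonian and finitely many jump operators $L_k$. Local detailed balance: the jump operators come in pairs $(k,k')$ ($k\mapsto k'$ an involution on the index set) with $L_k=e^{\Delta s_k/2}L_{k'}^\dagger$, $\Delta s_k\in\mathbb{R}$, $\Delta s_{k'}=-\Delta s_k$. The steady state $\pi$ is a density matrix with $\mathcal{L}(\pi)=0$; $\pi=\sum_n\pi_n|n\rangle\langle n|$ is a spectral decomposition in an orthonormal eigenbasis $\{|n\rangle\}$, which is fixed (it is the measurement basis). Adjoint generator. $\tilde{\mathcal{L}}(\varrho):=i[H,\varrho]+\sum_k\big(L_k^\dagger\varrho L_k-\tfrac12\{L_k^\dagger L_k,\varrho\}\big)$. It has eigenoperators $V_n$, $\tilde{\mathcal{L}}(V_n)=\lambda_nV_n$, with $0=\lambda_1>\mathrm{Re}\,\lambda_2\ge\mathrm{Re}\,\lambda_3\ge\dots$, normalized by $\|V_n\|_\infty=1$, with $V_1=\mathbb{1}$; the $V_n$ are assumed to form a basis of the space of operators and are fixed. $\|\cdot\|_\infty$ is the operator norm. Spectral gap: $g:=-\mathrm{Re}\,\lambda_2>0$. For an operator $X=\sum_n z_n^xV_n$: $\|X\|_*:=\sum_{n\ge2}|z_n^x|$, $X_t:=e^{\tilde{\mathcal{L}}t}(X)$, and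 $C_{\ell_1}(X_t):=e^{gt}\sum_{m\neq n}|\langle m|X_t|n\rangle|$. Correlations. $C_{ba}^\tau:=\mathrm{tr}\{B\,e^{\mathcal{L}\tau}(A\pi)\}$, $C_{ab}^\tau:=\mathrm{tr}\{A\,e^{\mathcal{L}\tau}(B\pi)\}$, $\delta C_{ba}^\tau:=C_{ba}^\tau-C_{ab}^\tau$. Rates. Entropy production rate $\sigma:=\sum_k\mathrm{tr}\{L_k\pi L_k^\dagger\}\Delta s_k$; dynamical activity rate $\gamma:=\sum_k\mathrm{tr}\{L_k\pi L_k^\dagger\}$. $\Phi:[0,\infty)\to[0,\infty)$ is the inverse function of $u\mapsto u\tanh u$ on $[0,\infty)$. When $\sigma=0$ the expression $\sigma/\Phi(\sigma/2\gamma)$ is understood as its limit $0$. *)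

(* Defs.v *)
From mathcomp Require Import all_boot all_order all_algebra.
From mathcomp Require Import complex.
From mathcomp Require Import all_classical all_reals all_analysis.

Set Implicit Arguments.
Unset Strict Implicit.
Unset Printing Implicit Defensive.

Import Order.TTheory GRing.Theory Num.Theory.
Import numFieldNormedType.Exports.

Local Open Scope classical_set_scope.
Local Open Scope ring_scope.
Local Open Scope complex_scope.
Local Open Scope sesquilinear_scope.

(* Real-valued complex modulus; the norm `|z| of [R[i]] lives in [R[i]]. *)
Definition cmod (R : realType) (z : R[i]) : R := complex.Re `|z|.

Definition l2norm (R : realType) (N : nat) (v : 'cV[R[i]]_N) : R :=
  Num.sqrt (\sum_i cmod (v i 0) ^+ 2).

Definition opnorm (R : realType) (N : nat) (X : 'M[R[i]]_N) : R :=
  sup [set l2norm (X *m v) | v in [set v | l2norm v <= 1]].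

Definition limC (R : realType) (u : nat -> R[i]) : R[i] :=
  Complex (limn (fun n => complex.Re (u n))) (limn (fun n => complex.Im (u n))).

(* e^{t S}(X) as the exponential power series of the superoperator S.  The limit
   is taken entrywise, on real and imaginary parts; in finite dimension this is
   convergence for any norm. *)
Definition expS (R : realType) (N : nat) (S : 'M[R[i]]_N -> 'M[R[i]]_N)
    (t : R) (X : 'M[R[i]]_N) : 'M[R[i]]_N :=
  \matrix_(i, j) limC (fun n =>
    (\sum_(k < n) (t ^+ k / k`!%:R)%:C *: iter k S X) i j).

Definition comm (R : realType) (N : nat) (X Y : 'M[R[i]]_N) : 'M[R[i]]_N :=
  X *m Y - Y *m X.

Definition acomm (R : realType) (N : nat) (X Y : 'M[R[i]]_N) : 'M[R[i]]_N :=
  X *m Y + Y *m X.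

Definition lindblad (R : realType) (N : nat) (K : finType)
    (H : 'M[R[i]]_N) (L : K -> 'M[R[i]]_N) (rho : 'M[R[i]]_N) : 'M[R[i]]_N :=
  - 'i *: comm H rho +
  \sum_k (L k *m rho *m (L k)^t* - 2^-1 *: acomm ((L k)^t* *m L k) rho).

Definition lindblad_adj (R : realType) (N : nat) (K : finType)
    (H : 'M[R[i]]_N) (L : K -> 'M[R[i]]_N) (rho : 'M[R[i]]_N) : 'M[R[i]]_N :=
  'i *: comm H rho +
  \sum_k ((L k)^t* *m rho *m L k - 2^-1 *: acomm ((L k)^t* *m L k) rho).

Definition local_detailed_balance (R : realType) (N : nat) (K : finType)
    (L : K -> 'M[R[i]]_N) (dual : K -> K) (ds : K -> R) : Prop :=
  [/\ involutive dual,
      forall k, L k = (expR (ds k / 2))%:C *: (L (dual k))^t* &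
      forall k, ds (dual k) = - ds k].

(* 0 <= z in [R[i]] means that z is real and nonnegative. *)
Definition density_matrix (R : realType) (N : nat) (rho : 'M[R[i]]_N) : Prop :=
  [/\ rho^t* = rho,
      forall v : 'cV[R[i]]_N, 0 <= (v^t* *m rho *m v) 0 0 &
      \tr rho = 1].

Definition orthonormal_basis (R : realType) (N : nat)
    (e : 'I_N -> 'cV[R[i]]_N) : Prop :=
  forall m n, ((e m)^t* *m e n) 0 0 = (m == n)%:R.

(* \sum_n a_n |n><n| *)
Definition diag_op (R : realType) (N : nat) (e : 'I_N -> 'cV[R[i]]_N)
    (a : 'I_N -> R) : 'M[R[i]]_N :=
  \sum_n (a n)%:C *: (e n *m (e n)^t*).

(* The eigenoperators V_1, V_2, ... and eigenvalues lambda_1, lambda_2, ... are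
   stored from index 0, so V`_0 = 1 and the gap involves lam`_1. *)
Definition adj_eigenbasis (R : realType) (N : nat) (K : finType)
    (H : 'M[R[i]]_N) (L : K -> 'M[R[i]]_N)
    (V : (N * N).-tuple 'M[R[i]]_N) (lam : (N * N).-tuple R[i]) : Prop :=
  [/\ basis_of fullv V,
      forall k, (k < N * N)%N -> lindblad_adj H L V`_k = lam`_k *: V`_k,
      forall k, (k < N * N)%N -> opnorm V`_k = 1,
      V`_0 = 1%:M &
      [/\ lam`_0 = 0,
          complex.Re lam`_1 < 0 &
          forall j k, (1 <= j)%N -> (j <= k)%N -> (k < N * N)%N ->
            complex.Re lam`_k <= complex.Re lam`_j]].

Definition gap (R : realType) (N : nat) (lam : (N * N).-tuple R[i]) : R :=
  - complex.Re lam`_1.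

Definition star_norm (R : realType) (N : nat) (V : (N * N).-tuple 'M[R[i]]_N)
    (X : 'M[R[i]]_N) : R :=
  \sum_(k < N * N | (0 < k)%N) cmod (coord V k X).

(* C_{l1}(X_t), with X_t the Heisenberg evolution of X. *)
Definition coherence (R : realType) (N : nat) (K : finType)
    (H : 'M[R[i]]_N) (L : K -> 'M[R[i]]_N) (e : 'I_N -> 'cV[R[i]]_N) (g : R)
    (X : 'M[R[i]]_N) (t : R) : R :=
  expR (g * t) *
  \sum_m \sum_(n | m != n)
    cmod (((e m)^t* *m expS (lindblad_adj H L) t X *m e n) 0 0).

(* corr H L pi B A tau = tr {B e^{L tau}(A pi)} *)
Definition corr (R : realType) (N : nat) (K : finType)
    (H : 'M[R[i]]_N) (L : K -> 'M[R[i]]_N) (pi B A : 'M[R[i]]_N)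
    (tau : R) : R[i] :=
  \tr (B *m expS (lindblad H L) tau (A *m pi)).

(* The traces tr {L_k pi L_k^dagger} are real, so the real part loses nothing. *)
Definition entropy_production (R : realType) (N : nat) (K : finType)
    (L : K -> 'M[R[i]]_N) (ds : K -> R) (pi : 'M[R[i]]_N) : R :=
  \sum_k complex.Re (\tr (L k *m pi *m (L k)^t*)) * ds k.

Definition dynamical_activity (R : realType) (N : nat) (K : finType)
    (L : K -> 'M[R[i]]_N) (pi : 'M[R[i]]_N) : R :=
  \sum_k complex.Re (\tr (L k *m pi *m (L k)^t*)).

Definition tanh (R : realType) (u : R) : R :=
  (expR u - expR (- u)) / (expR u + expR (- u)).

(* Inverse function of u |-> u tanh u on [0, +oo[; only meaningful for 0 <= y. *)
Definition Phi (R : realType) (y : R) : R :=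
  xget 0 [set u : R | 0 <= u /\ u * tanh u = y].

(* sigma / Phi (sigma / 2 gamma), extended by its limit at sigma = 0. *)
Definition thermo_term (R : realType) (sigma gamma : R) : R :=
  if sigma == 0 then 0 else sigma / Phi (sigma / (2 * gamma)).

Definition Theta (R : realType) (N : nat) (K : finType)
    (H : 'M[R[i]]_N) (L : K -> 'M[R[i]]_N) : R :=
  4 * opnorm H + 3 * \sum_k opnorm (L k) ^+ 2.

Definition coherence_term (R : realType) (N : nat) (K : finType)
    (H : 'M[R[i]]_N) (L : K -> 'M[R[i]]_N) (e : 'I_N -> 'cV[R[i]]_N)
    (V : (N * N).-tuple 'M[R[i]]_N) (g : R) (A B : 'M[R[i]]_N) (tau : R) : R :=
  Theta H L *
  \int[lebesgue_measure]_(s in `[0%R, 1%R])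
    (star_norm V B * coherence H L e g A ((1 - s) * tau) +
     star_norm V A * coherence H L e g B (s * tau)).

(* Main.v *)
(** Heisenberg-evolved operators turn both correlations into values of one
    function: f(s) = tr(B_{s tau} A_{(1-s) tau} pi) satisfies f(1) = C_ba and
    f(0) = C_ab (A, B and pi commute), and f'(s) = tau T(B_{s tau}, A_{(1-s) tau})
    with T(X, Y) = tr((L~(X) Y - X L~(Y)) pi).  Stationarity makes T insensitive
    to the V_1-components, so X and Y may be replaced by their decaying parts, of
    operator norm at most e^{-gt} times their star norm.

    Split X and Y into diagonal and off-diagonal parts in the eigenbasis of pi.
    Whenever an off-diagonal part occurs, T is bounded by its l1 norm times Theta
    times the norm of the other argument; the constant 3 in Theta comes from the
    cancellation of the terms with L_k^* L_k between X and Y.  On diagonal parts T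
    reduces to the fluxes of a classical Markov jump process, and the sum of the
    absolute net fluxes is at most sigma / Phi(sigma / 2 gamma), by concavity of
    v tanh v |-> tanh v applied to v = half the affinity of a jump. *)

Require Import Defs.
From HB Require Import structures.
From mathcomp Require Import all_boot all_order all_algebra.
From mathcomp Require Import complex.
From mathcomp Require Import all_classical all_reals all_analysis.
From mathcomp Require Import ring lra.

Set Implicit Arguments.
Unset Strict Implicit.
Unset Printing Implicit Defensive.

Import Order.TTheory GRing.Theory Num.Theory.
Import numFieldNormedType.Exports.

Local Open Scope classical_set_scope.
Local Open Scope ring_scope.
Local Open Scope complex_scope.
Local Open Scope sesquilinear_scope.

(** * Hyperbolic functions and the thermodynamic flux bound *)

Definition sh (R : realType) (x : R) : R := (expR x - expR (- x)) / 2.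
Definition ch (R : realType) (x : R) : R := (expR x + expR (- x)) / 2.

Section PointwiseDerivatives.
Variables (R : realType) (f g : R -> R) (x df dg : R).

Lemma is_derive_funD : is_derive x 1 f df -> is_derive x 1 g dg ->
  is_derive x 1 (fun t => f t + g t) (df + dg).
Proof. by move=> hf hg; exact: is_deriveD. Qed.

Lemma is_derive_funB : is_derive x 1 f df -> is_derive x 1 g dg ->
  is_derive x 1 (fun t => f t - g t) (df - dg).
Proof. by move=> hf hg; exact: is_deriveB. Qed.

Lemma is_derive_funM : is_derive x 1 f df -> is_derive x 1 g dg ->
  is_derive x 1 (fun t => f t * g t) (df * g x + f x * dg).
Proof.
move=> hf hg; have h := is_deriveM hf hg.
by rewrite addrC (mulrC df).
Qed.

Lemma is_derive_funMl c : is_derive x 1 f df ->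
  is_derive x 1 (fun t => c * f t) (c * df).
Proof. by move=> hf; exact: is_deriveZ. Qed.

Lemma is_derive_fun_id : is_derive x 1 (id : R -> R) 1.
Proof. exact: is_derive_id. Qed.

Lemma is_derive_fun_cst (c : R) : is_derive x 1 (cst c : R -> R) 0.
Proof. exact: is_derive_cst. Qed.

Lemma is_derive_continuous : is_derive x 1 f df -> {for x, continuous f}.
Proof.
move=> [h _]; apply: differentiable_continuous; exact/derivable1_diffP.
Qed.

End PointwiseDerivatives.

Lemma is_derive_fun_comp (R : realType) (f h : R -> R) (x df dh : R) :
  is_derive x 1 h dh -> is_derive (h x) 1 f df ->
  is_derive x 1 (fun t => f (h t)) (df * dh).
Proof. by move=> hh hf; have := is_derive1_comp hf hh. Qed.

Lemma is_derive_fun_sum (R : realType) (I : finType) (f : I -> R -> R) (x : R)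
    (df : I -> R) : (forall i, is_derive x 1 (f i) (df i)) ->
  is_derive x 1 (fun t => \sum_i f i t) (\sum_i df i).
Proof.
move=> h; elim: (index_enum I) => [|i r IH].
  rewrite big_nil; under eq_fun do rewrite big_nil.
  exact: is_derive_fun_cst.
rewrite big_cons; under eq_fun do rewrite big_cons.
exact: is_derive_funD (h i) IH.
Qed.

Section Hyperbolic.
Variable R : realType.
Implicit Types x y u v p q : R.

(** The mean value theorem on [[0, x]]. The inequalities on [sh] and [ch] below are chained through
    it: each derivative is nonnegative by an earlier one. *)
Lemma ge0_of_derive (f df : R -> R) x : (forall y, is_derive y 1 f (df y)) ->
  f 0 = 0 -> (forall y, 0 <= y -> 0 <= df y) -> 0 <= x -> 0 <= f x.
Proof.
move=> Hd f0 dfge x0.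
have [|c] := @MVT_segment R f df 0 x x0 (fun y _ => Hd y).
  by apply: continuous_subspaceT => y; exact: is_derive_continuous (Hd y).
rewrite in_itv/= => /andP[c0 _]; rewrite f0 !subr0 => ->.
by rewrite mulr_ge0// dfge.
Qed.

Lemma is_derive_expRN x : is_derive x 1 (fun t : R => expR (- t)) (- expR (- x)).
Proof.
by rewrite -mulrN1; apply: is_derive_fun_comp.
Qed.

Lemma is_derive_sh x : is_derive x 1 (@sh R) (ch x).
Proof.
rewrite /sh /ch; under eq_fun do rewrite mulrC.
have h := is_derive_funMl 2^-1 (is_derive_funB (is_derive_expR x) (is_derive_expRN x)).
apply: is_derive_eq h _.
by rewrite opprK mulrC.
Qed.

Lemma is_derive_ch x : is_derive x 1 (@ch R) (sh x).
Proof.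
rewrite /sh /ch; under eq_fun do rewrite mulrC.
have h := is_derive_funMl 2^-1 (is_derive_funD (is_derive_expR x) (is_derive_expRN x)).
apply: is_derive_eq h _.
by rewrite mulrC.
Qed.

Lemma ch_gt0 x : 0 < ch x.
Proof. by rewrite divr_gt0// addr_gt0// expR_gt0. Qed.

Lemma sh0 : sh (0 : R) = 0. Proof. by rewrite /sh oppr0 subrr mul0r. Qed.

Lemma ch0 : ch (0 : R) = 1.
Proof. by rewrite /ch oppr0 expR0 divff. Qed.

Lemma sh_ge0 x : 0 <= x -> 0 <= sh x.
Proof.
by move=> x0; apply: (ge0_of_derive is_derive_sh) => // [|y _]; rewrite ?sh0 ?ltW ?ch_gt0.
Qed.

Lemma ch_sub1_ge0 x : 0 <= x -> 0 <= ch x - 1.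
Proof.
apply: (@ge0_of_derive (fun x => ch x - 1) (@sh R)) => [y||y].
- rewrite -[sh y]subr0; exact: is_derive_funB (is_derive_ch y) (is_derive_fun_cst y 1).
- by rewrite ch0 subrr.
- exact: sh_ge0.
Qed.

Lemma sh_ge_id x : 0 <= x -> x <= sh x.
Proof.
move=> x0; rewrite -subr_ge0.
apply: (@ge0_of_derive (fun x => sh x - x) (fun x => ch x - 1)) x0 => [y||y].
- exact: is_derive_funB (is_derive_sh y) (is_derive_fun_id y).
- by rewrite sh0 subrr.
- exact: ch_sub1_ge0.
Qed.

Lemma sh_le_mul_ch x : 0 <= x -> sh x <= x * ch x.
Proof.
move=> x0; rewrite -subr_ge0.
apply: (@ge0_of_derive (fun x => x * ch x - sh x) (fun x => x * sh x)) x0 => [y||y y0].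
- have h := is_derive_funB
    (is_derive_funM (is_derive_fun_id y) (is_derive_ch y)) (is_derive_sh y).
  by apply: is_derive_eq h _; rewrite mul1r addrAC subrr add0r.
- by rewrite sh0 mul0r subrr.
- by rewrite mulr_ge0 ?sh_ge0.
Qed.

Lemma shN u : sh (- u) = - sh u.
Proof. by rewrite /sh opprK -mulNr opprB. Qed.

Lemma shB u v : sh (u - v) = sh u * ch v - ch u * sh v.
Proof. by rewrite /sh /ch opprB !expRD; field. Qed.

Lemma shD u v : sh (u + v) = sh u * ch v + ch u * sh v.
Proof. by rewrite /sh /ch opprD !expRD; field. Qed.

Lemma sh_homo u v : 0 <= u -> u <= v -> sh u <= sh v.
Proof.
move=> u0 uv; rewrite -(subrK u v) shD.
have h1 : 0 <= ch (v - u) - 1 by rewrite ch_sub1_ge0// subr_ge0.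
have h2 : 0 <= sh (v - u) by rewrite sh_ge0// subr_ge0.
by have := sh_ge0 u0; have := ch_gt0 u; nra.
Qed.

(* The tangent line at [u * tanh u] of the concave function
   [v * tanh v |-> tanh v], with denominators cleared. *)
Lemma tanh_tangent_line u v : 0 <= u -> 0 <= v ->
  sh v * (sh u * ch u + u - v) <= sh u ^+ 2 * ch v.
Proof.
(* By the subtraction formula for [sh] the two inequalities are equivalent. If [v <= u], compare
   factor by factor; otherwise set [d = v - u], expand [sh v] as [sh (u + d)] and use
   [sh d <= d * ch d]. *)
move=> u0 v0; suff: sh v * (u - v) <= sh u * sh (u - v) by rewrite shB; nra.
have [vu|/ltW uv] := leP v u.
  apply: ler_pM; [exact: sh_ge0|by rewrite subr_ge0|exact: sh_homo|].
  by apply: sh_ge_id; rewrite subr_ge0.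
have d0 : 0 <= v - u by rewrite subr_ge0.
have h : (sh u * ch (v - u) + ch u * sh (v - u)) * (v - u) >= sh u * sh (v - u).
  have := sh_le_mul_ch d0; have := sh_ge0 u0; have := sh_ge0 d0.
  have := ch_gt0 u => hc hd hu hs.
  have : 0 <= sh u * ((v - u) * ch (v - u) - sh (v - u)).
    by apply: mulr_ge0 => //; rewrite subr_ge0.
  have : 0 <= ch u * sh (v - u) * (v - u).
    by apply: mulr_ge0 => //; apply: mulr_ge0 => //; exact: ltW.
  nra.
have uvE : u + (v - u) = v by ring.
rewrite -shD uvE in h.
have -> : u - v = - (v - u) by rewrite opprB.
rewrite shN.
by rewrite !mulrN lerN2.
Qed.

Lemma tanhE u : tanh u = sh u / ch u.
Proof.
rewrite /tanh /sh /ch; field.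
by rewrite gt_eqF// addr_gt0// expR_gt0.
Qed.

Lemma PhiP y : 0 <= y -> 0 <= Phi y /\ Phi y * tanh (Phi y) = y.
Proof.
move=> y0; rewrite /Phi; case: xgetP => [//|] /(_ _) none.
have ch0 v : ch v != 0 by rewrite gt_eqF ?ch_gt0.
have cont : continuous (fun x : R => x * (sh x * (ch x)^-1)).
  move=> x; apply: cvgM; first exact: cvg_id.
  apply: cvgM; last apply: cvgV => //.
    exact: is_derive_continuous (is_derive_sh x).
  exact: is_derive_continuous (is_derive_ch x).
pose t1 : R := sh 1 / ch 1.
have t1_gt0 : 0 < t1 by rewrite divr_gt0 ?ch_gt0// (lt_le_trans ltr01)// sh_ge_id.
(* Right end for the intermediate value theorem: [t1] is [tanh 1], and [tanh b >= t1] since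
   [b >= 1], so [b * tanh b >= b * t1 = t1 + y >= y]. *)
pose b := 1 + y / t1.
have b1 : 1 <= b by rewrite lerDl divr_ge0// ltW.
have b0 : 0 <= b by rewrite (le_trans _ b1).
have t1b : t1 <= sh b / ch b.
  rewrite /t1 ler_pdivrMr ?ch_gt0// mulrAC ler_pdivlMr ?ch_gt0//.
  by have := @sh_ge0 (b - 1); rewrite subr_ge0 b1 shB => /(_ isT); nra.
have [||c] := @IVT R (fun x : R => x * (sh x * (ch x)^-1)) 0 b y b0.
- exact: continuous_subspaceT.
- rewrite mul0r ge_min y0/= le_max; apply/orP; right.
  rewrite (@le_trans _ _ (b * t1))//; last by rewrite ler_wpM2l.
  by rewrite mulrDl mul1r divfK ?gt_eqF// lerDr ltW.
rewrite in_itv/= => /andP[c0 _] cy.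
by case: (none c); split => //; rewrite tanhE.
Qed.

End Hyperbolic.

Section ThermoBound.
Variables (R : realType) (I : finType) (rho : I -> I) (F theta : I -> R).
Hypotheses (rhoK : involutive rho) (F0 : forall i, 0 <= F i)
  (FE : forall i, F i = expR (theta i) * F (rho i))
  (thetaN : forall i, theta (rho i) = - theta i).

Lemma sum_involution (V : nmodType) (G : I -> V) : \sum_i G (rho i) = \sum_i G i.
Proof. by rewrite [RHS](reindex rho)//; apply: onW_bij; exists rho. Qed.

(** Both sides are invariant under [i |-> rho i], which reduces to [0 <= theta i]. With
    [v = theta i / 2], the claim is then [2 * q] times [tanh_tangent_line]. *)
Lemma flux_tangent_line u i : 0 <= u ->
  `|F i - F (rho i)| * (sh u * ch u + u) <=
  (F i + F (rho i)) * sh u ^+ 2 + (F i - F (rho i)) * theta i / 2.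
Proof.
move=> u0; wlog t0 : i / 0 <= theta i => [wl|].
  case: (leP 0 (theta i)) => [|/ltW t0]; first exact: wl.
  have := wl (rho i); rewrite rhoK thetaN oppr_ge0 => /(_ t0).
  by rewrite distrC (addrC (F (rho i))) -(opprB (F i)) mulrNN.
(* [q] is the geometric mean of [F i] and [F (rho i)], so that these are [q] times [expR v] and
   [expR (- v)]. *)
set q := expR (theta i / 2) * F (rho i).
have q0 : 0 <= q by rewrite mulr_ge0 ?expR_ge0.
have Fi : F i = expR (theta i / 2) * q.
  by rewrite FE /q mulrA -expRD -splitr.
have Fr : F (rho i) = expR (- (theta i / 2)) * q.
  by rewrite /q mulrA -expRD addNr expR0 mul1r.
have dE : F i - F (rho i) = 2 * q * sh (theta i / 2) by rewrite Fi Fr /sh; field.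
have sE : F i + F (rho i) = 2 * q * ch (theta i / 2) by rewrite Fi Fr /ch; field.
have v0 : 0 <= theta i / 2 by rewrite divr_ge0.
have shv0 := sh_ge0 v0.
rewrite dE sE ger0_norm; last by rewrite mulr_ge0// mulr_ge0.
rewrite -subr_ge0; set v := theta i / 2.
have := tanh_tangent_line u0 v0; rewrite -/v -subr_ge0 => h.
have -> : 2 * q * sh v * theta i = 2 * q * sh v * v * 2 by rewrite /v; field.
by have := mulr_ge0 q0 h; nra.
Qed.

Let sigma := \sum_i F i * theta i.
Let gamma := \sum_i F i.

Let sigmaE : \sum_i (F i - F (rho i)) * theta i / 2 = sigma.
Proof.
rewrite -mulr_suml.
under eq_bigr do rewrite mulrBl.
rewrite sumrB.
have -> : \sum_i F (rho i) * theta i = - sigma.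
  rewrite -sum_involution -sumrN; apply: eq_bigr => i _.
  by rewrite rhoK thetaN mulrN.
by rewrite -/sigma; field.
Qed.

(** Summing the tangent lines gives a bound [tl] for every slope parameter [u]. At
    [u = Phi (sigma / (2 * gamma))] one has [sigma = 2 * gamma * u * tanh u], so the right side of
    [tl] factors as [2 * gamma * tanh u * (sh u * ch u + u)], and [2 * gamma * tanh u] is
    [sigma / u]. *)
Lemma flux_le_thermo_term : \sum_i `|F i - F (rho i)| <= thermo_term sigma gamma.
Proof.
have tl u : 0 <= u -> (\sum_i `|F i - F (rho i)|) * (sh u * ch u + u) <=
    2 * gamma * sh u ^+ 2 + sigma.
  move=> u0; rewrite mulr_suml -sigmaE.
  have -> : 2 * gamma = \sum_i (F i + F (rho i)).
    by rewrite big_split/= sum_involution mulr_natl mulr2n.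
  rewrite mulr_suml -big_split/=; apply: ler_sum => i _.
  exact: flux_tangent_line.
have gamma0 : 0 <= gamma by apply: sumr_ge0.
(* The second law is the case [u = 0]. *)
have sigma0 : 0 <= sigma by have := tl 0 (lexx 0); rewrite sh0; lra.
have S0 : 0 <= \sum_i `|F i - F (rho i)| by apply: sumr_ge0.
rewrite /thermo_term; case: ifPn => [/eqP sigma_eq0|sigma_neq0].
  (* Divide the tangent-line bound by [u] and let [u] tend to 0. *)
  rewrite leNgt; apply/negP => S_gt0.
  set S := \sum_i _ in tl S0 S_gt0.
  rewrite sigma_eq0 in tl.
  have bnd u : 0 < u -> S <= 2 * gamma * sh u.
    move=> u0; have := tl u (ltW u0) => h.
    have shu : 0 < sh u by rewrite (lt_le_trans u0)// sh_ge_id// ltW.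
    have h1 := ch_sub1_ge0 (ltW u0).
    suff : S * sh u <= 2 * gamma * sh u * sh u by rewrite ler_pM2r.
    rewrite addr0 expr2 mulrA in h; apply: le_trans h.
    by rewrite ler_wpM2l//; nra.
  have shc : sh x @[x --> (0 : R)] --> sh (0 : R).
    exact: is_derive_continuous (is_derive_sh 0).
  (* Continuity of [sh] at 0 will give a point where [(2 * gamma + 1) * sh < S], against [bnd]; the
     [+ 1] keeps the denominator positive even if [gamma] vanishes. *)
  have g1 : 0 < S / (2 * gamma + 1).
    by rewrite divr_gt0// ltr_wpDl ?mulr_ge0.
  move/cvgrPdist_lt/(_ _ g1) : shc => [d/= d0 hd].
  have d2 : 0 < d / 2 by rewrite divr_gt0.
  have dd : d / 2 < d by rewrite ltr_pdivrMr// ltr_pMr// ltrDl.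
  have hh : `|sh (0 : R) - sh (d / 2)| < S / (2 * gamma + 1).
    by apply: hd; rewrite /ball_/= sub0r normrN gtr0_norm.
  rewrite sh0 sub0r normrN in hh.
  have hs : 0 <= sh (d / 2) by exact/sh_ge0/ltW.
  rewrite ger0_norm// ltr_pdivlMr in hh; last by rewrite ltr_wpDl ?mulr_ge0.
  by have := bnd _ d2; nra.
have sigma_gt0 : 0 < sigma by rewrite lt_def sigma_neq0.
have gamma_gt0 : 0 < gamma.
  rewrite lt_def gamma0 andbT; apply/eqP => g0.
  have F_eq0 i : F i = 0.
    by have /psumr_eq0P := g0; apply.
  by move: sigma_gt0; rewrite /sigma big1 ?ltxx// => i _; rewrite F_eq0 mul0r.
have [] := @PhiP R (sigma / (2 * gamma)).
  by rewrite divr_ge0// mulr_ge0.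
set u := Phi _ => u0 uE.
have u_gt0 : 0 < u.
  rewrite lt_def u0 andbT; apply/eqP => ueq; move: uE; rewrite ueq mul0r => /esym/eqP.
  by rewrite gt_eqF// divr_gt0// mulr_gt0.
have c0 := ch_gt0 u.
have sE : sigma = 2 * gamma * u * (sh u / ch u).
  rewrite -mulrA -tanhE uE; field; exact: lt0r_neq0.
have shu := sh_ge0 u0.
have D0 : 0 < sh u * ch u + u by rewrite ltr_wpDl// mulr_ge0// ltW.
rewrite -(ler_pM2r D0); apply: le_trans (tl u u0) _.
rewrite sE le_eqVlt; apply/orP; left; apply/eqP; field.
by rewrite !lt0r_neq0.
Qed.

End ThermoBound.

(** * Complex exponentials *)

Section ComplexBasics.
Variable R : realType.
Implicit Types z w : R[i].

Lemma complexReD z w : complex.Re (z + w) = complex.Re z + complex.Re w.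
Proof. by case: z => ? ?; case: w. Qed.

Lemma complexImD z w : complex.Im (z + w) = complex.Im z + complex.Im w.
Proof. by case: z => ? ?; case: w. Qed.

Lemma complexReM z w :
  complex.Re (z * w) = complex.Re z * complex.Re w - complex.Im z * complex.Im w.
Proof. by case: z => ? ?; case: w. Qed.

Lemma complexImM z w :
  complex.Im (z * w) = complex.Re z * complex.Im w + complex.Im z * complex.Re w.
Proof. by case: z => ? ?; case: w. Qed.

Lemma Re_sum (I : finType) (F : I -> R[i]) :
  complex.Re (\sum_i F i) = \sum_i complex.Re (F i).
Proof. by elim/big_ind2 : _ => // x1 x2 y1 y2 <- <-; rewrite complexReD. Qed.

Lemma Im_sum (I : finType) (F : I -> R[i]) :
  complex.Im (\sum_i F i) = \sum_i complex.Im (F i).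
Proof. by elim/big_ind2 : _ => // x1 x2 y1 y2 <- <-; rewrite complexImD. Qed.

Lemma complex_ext z w :
  complex.Re z = complex.Re w -> complex.Im z = complex.Im w -> z = w.
Proof. by case: z => a b; case: w => c d /= -> ->. Qed.

Lemma Im_as_Re z : complex.Im z = complex.Re (Complex 0 (-1) * z).
Proof. by rewrite complexReM/= mul0r sub0r mulN1r opprK. Qed.

Lemma cmodE z : cmod z = Num.sqrt (complex.Re z ^+ 2 + complex.Im z ^+ 2).
Proof. by rewrite /cmod normc_def. Qed.

Lemma cmodC z : (cmod z)%:C = `|z|.
Proof. by rewrite /cmod normc_def. Qed.

Lemma cmod_ge0 z : 0 <= cmod z. Proof. by rewrite cmodE sqrtr_ge0. Qed.

Lemma cmod0 : cmod (0 : R[i]) = 0.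
Proof. by rewrite cmodE/= expr0n addr0 sqrtr0. Qed.

Lemma cmodM z w : cmod (z * w) = cmod z * cmod w.
Proof. by apply/complexI; rewrite rmorphM/= !cmodC normrM. Qed.

Lemma cmodX z n : cmod (z ^+ n) = cmod z ^+ n.
Proof. by apply/complexI; rewrite rmorphXn/= !cmodC normrX. Qed.

Lemma cmodN z : cmod (- z) = cmod z.
Proof. by apply/complexI; rewrite !cmodC normrN. Qed.

Lemma cmodD z w : cmod (z + w) <= cmod z + cmod w.
Proof. by rewrite -lecR rmorphD/= !cmodC ler_normD. Qed.

Lemma cmodB z w : cmod (z - w) <= cmod z + cmod w.
Proof. by rewrite -(cmodN w) cmodD. Qed.

Lemma cmod_sum (I : finType) (P : pred I) (F : I -> R[i]) :
  cmod (\sum_(i | P i) F i) <= \sum_(i | P i) cmod (F i).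
Proof.
elim/big_ind2 : _ => [|x1 x2 y1 y2 h1 h2|//]; first by rewrite cmod0.
by apply: le_trans (cmodD _ _) _; rewrite lerD.
Qed.

Lemma cmod_real (x : R) : cmod x%:C = `|x|.
Proof. by rewrite cmodE/= expr0n/= addr0 sqrtr_sqr. Qed.

Lemma cmod1 : cmod (1 : R[i]) = 1.
Proof. by rewrite (cmod_real 1) normr1. Qed.

Lemma cmod_i : cmod ('i : R[i]) = 1.
Proof. by rewrite cmodE/= expr0n/= add0r expr1n sqrtr1. Qed.

Lemma cmod_conj z : cmod z^*%R = cmod z.
Proof. by apply/complexI; rewrite !cmodC norm_conjC. Qed.

Lemma conjM_cmod z : z^*%R * z = (cmod z ^+ 2)%:C.
Proof. by rewrite rmorphXn/= cmodC normCK mulrC. Qed.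

Lemma normr_Re_le z : `|complex.Re z| <= cmod z.
Proof.
by rewrite cmodE -sqrtr_sqr ler_wsqrtr// lerDl sqr_ge0.
Qed.

Lemma Re_le_cmod z : complex.Re z <= cmod z.
Proof. exact: le_trans (ler_norm _) (normr_Re_le z). Qed.

(** The phase is the conjugate of [z] divided by its modulus. It turns the modulus of a complex
    increment into the real part of a rotated one, to which real calculus applies. *)
Lemma cmod_phase z : exists2 u : R[i], cmod u = 1 & complex.Re (u * z) = cmod z.
Proof.
have [->|z0] := eqVneq z 0; first by exists 1; rewrite ?cmod1// mulr0 cmod0.
have c0 : cmod z != 0.
  by apply/eqP => h; move: z0; rewrite -normr_eq0 -cmodC h eqxx.
exists ((cmod z)^-1%:C * z^*%R).
  by rewrite cmodM cmod_conj cmod_real ger0_norm ?invr_ge0 ?cmod_ge0// mulVf.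
by rewrite -mulrA conjM_cmod -rmorphM/= expr2 mulKf.
Qed.

End ComplexBasics.

(* Componentwise limits and derivatives: [R[i]] carries no topology over [R]. *)
Definition cvgC (R : realType) (u : nat -> R[i]) (l : R[i]) : Prop :=
  (fun n => complex.Re (u n)) @ \oo --> complex.Re l /\
  (fun n => complex.Im (u n)) @ \oo --> complex.Im l.

Definition is_deriveC (R : realType) (f : R -> R[i]) (t : R) (df : R[i]) : Prop :=
  is_derive t 1 (fun x => complex.Re (f x)) (complex.Re df) /\
  is_derive t 1 (fun x => complex.Im (f x)) (complex.Im df).

Section ComplexLimits.
Variable R : realType.
Implicit Types (u : nat -> R[i]) (z w : R[i]).

Lemma cvgC_limC u z : cvgC u z -> limC u = z.
Proof.
by move=> [h1 h2]; apply: complex_ext; rewrite /limC/=; exact: cvg_lim.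
Qed.

Lemma cvgC_Ml z u w : cvgC u w -> cvgC (fun n => z * u n) (z * w).
Proof.
move=> [h1 h2]; split; under eq_fun do rewrite ?complexReM ?complexImM;
  rewrite ?complexReM ?complexImM.
  by apply: cvgB; apply: cvgMr.
by apply: cvgD; apply: cvgMr.
Qed.

Lemma cvgC_sum (I : finType) (u : I -> nat -> R[i]) (w : I -> R[i]) :
  (forall i, cvgC (u i) (w i)) -> cvgC (fun n => \sum_i u i n) (\sum_i w i).
Proof.
move=> h; split; under eq_fun do rewrite ?Re_sum ?Im_sum; rewrite ?Re_sum ?Im_sum.
  by apply: cvg_big => [|i _]; [exact: add_continuous|have [] := h i].
by apply: cvg_big => [|i _]; [exact: add_continuous|have [] := h i].
Qed.

Lemma is_deriveC_Ml z f t df : is_deriveC f t df ->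
  is_deriveC (fun x : R => z * f x) t (z * df).
Proof.
move=> [h1 h2]; split; under eq_fun do rewrite ?complexReM ?complexImM;
  rewrite ?complexReM ?complexImM.
  by apply: is_derive_funB; apply: is_derive_funMl.
by apply: is_derive_funD; apply: is_derive_funMl.
Qed.

Lemma is_deriveC_M f g t df dg : is_deriveC f t df -> is_deriveC g t dg ->
  is_deriveC (fun x : R => f x * g x) t (df * g t + f t * dg).
Proof.
move=> [f1 f2] [g1 g2]; split; under eq_fun do rewrite ?complexReM ?complexImM.
  apply: is_derive_eq (is_derive_funB (is_derive_funM f1 g1) (is_derive_funM f2 g2)) _.
  by rewrite complexReD !complexReM; ring.
apply: is_derive_eq (is_derive_funD (is_derive_funM f1 g2) (is_derive_funM f2 g1)) _.
by rewrite complexImD !complexImM; ring.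
Qed.

Lemma is_deriveC_sum (I : finType) (f : I -> R -> R[i]) t df :
  (forall i, is_deriveC (f i) t (df i)) ->
  is_deriveC (fun x : R => \sum_i f i x) t (\sum_i df i).
Proof.
move=> h; split; under eq_fun do rewrite ?Re_sum ?Im_sum; rewrite ?Re_sum ?Im_sum.
  by apply: is_derive_fun_sum => i; have [] := h i.
by apply: is_derive_fun_sum => i; have [] := h i.
Qed.

Lemma is_deriveC_comp f (h : R -> R) (t : R) df (dh : R) : is_derive t 1 h dh ->
  is_deriveC f (h t) df -> is_deriveC (fun x => f (h x)) t (dh%:C * df).
Proof.
move=> hh [f1 f2]; split; rewrite ?complexReM ?complexImM/= mul0r ?subr0 ?addr0 mulrC.
  exact: is_derive_fun_comp hh f1.
exact: is_derive_fun_comp hh f2.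
Qed.

End ComplexLimits.

(** The factor [u] lets one real power series serve for both components of the exponential, [u = 1]
    for the real and [u = -i] for the imaginary part. The family is also closed under
    differentiation, which replaces [u] by [u * l]. *)
Definition exp_coeffC (R : realType) (u l : R[i]) (k : nat) : R :=
  complex.Re (u * l ^+ k) / k`!%:R.

Definition cexp (R : realType) (l : R[i]) (t : R) : R[i] :=
  Complex (limn (pseries (exp_coeffC 1 l) t))
          (limn (pseries (exp_coeffC (Complex 0 (-1)) l) t)).

Section ComplexExponential.
Variable R : realType.
Implicit Types (u l : R[i]) (t : R).

Lemma is_cvg_exp_coeffC u l t : cvgn (pseries (exp_coeffC u l) t).
Proof.
apply: normed_cvg.
have h0 n : 0 <= cmod u * exp_coeff (cmod l * `|t|) n.
  by rewrite mulr_ge0 ?cmod_ge0// exp_coeff_ge0// mulr_ge0 ?cmod_ge0.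
apply: series_le_cvg h0 _ _ => [n|n|]; first exact: normr_ge0.
  rewrite /exp_coeffC /exp_coeff/= normrM normrX normrM exprMn.
  rewrite normfV (@ger0_norm _ n`!%:R)//.
  rewrite mulrA mulrA mulrAC ler_wpM2r// ?invr_ge0//.
  rewrite ler_wpM2r ?exprn_ge0//.
  by rewrite (le_trans (normr_Re_le _))// cmodM cmodX.
have -> : (fun n => cmod u * exp_coeff (cmod l * `|t|) n) =
    cmod u \*: exp_coeff (cmod l * `|t|) by apply/funext.
exact/is_cvg_seriesZ/is_cvg_series_exp_coeff.
Qed.

Lemma pseries_diffs_exp_coeffC u l :
  pseries_diffs (exp_coeffC u l) = exp_coeffC (u * l) l.
Proof.
apply/funext => k; rewrite /pseries_diffs /exp_coeffC exprS mulrA.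
by rewrite factS natrM invfM mulrCA (mulrA k.+1%:R) divff// mul1r.
Qed.

Lemma is_derive_exp_coeffC u l t :
  is_derive t 1 (fun x => limn (pseries (exp_coeffC u l) x))
    (limn (pseries (exp_coeffC (u * l) l) t)).
Proof.
rewrite -pseries_diffs_exp_coeffC; apply: (@pseries_snd_diffs R _ (`|t| + 1)).
- exact: is_cvg_exp_coeffC.
- by rewrite pseries_diffs_exp_coeffC; exact: is_cvg_exp_coeffC.
- by rewrite !pseries_diffs_exp_coeffC; exact: is_cvg_exp_coeffC.
- by rewrite (@ger0_norm _ (`|t| + 1)) ?ltrDl// addr_ge0.
Qed.

Lemma pseries_exp_coeffC_partial u l t n : pseries (exp_coeffC u l) t n =
  complex.Re (u * \sum_(k < n) (t ^+ k / k`!%:R)%:C * l ^+ k).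
Proof.
rewrite /pseries/series/= big_mkord mulr_sumr Re_sum; apply: eq_bigr => k _.
rewrite mulrCA complexReM/= mul0r subr0 /exp_coeffC; ring.
Qed.

Lemma cvgC_cexp l t :
  cvgC (fun n => \sum_(k < n) (t ^+ k / k`!%:R)%:C * l ^+ k) (cexp l t).
Proof.
split.
  rewrite (_ : (fun n => _) = pseries (exp_coeffC 1 l) t).
    exact: is_cvg_exp_coeffC.
  by apply/funext => n; rewrite pseries_exp_coeffC_partial mul1r.
rewrite (_ : (fun n => _) = pseries (exp_coeffC (Complex 0 (-1)) l) t).
  exact: is_cvg_exp_coeffC.
by apply/funext => n; rewrite pseries_exp_coeffC_partial -Im_as_Re.
Qed.

Lemma lim_exp_coeffC u l t :
  limn (pseries (exp_coeffC u l) t) = complex.Re (u * cexp l t).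
Proof.
have [h _] := cvgC_Ml u (cvgC_cexp l t).
rewrite (_ : (fun n => _) = pseries (exp_coeffC u l) t) in h; first exact: cvg_lim.
by apply/funext => n; rewrite pseries_exp_coeffC_partial.
Qed.

Lemma is_deriveC_cexp l t : is_deriveC (cexp l) t (l * cexp l t).
Proof.
split.
  apply: is_derive_eq (is_derive_exp_coeffC 1 l t) _.
  by rewrite lim_exp_coeffC mul1r.
apply: is_derive_eq (is_derive_exp_coeffC (Complex 0 (-1)) l t) _.
by rewrite lim_exp_coeffC -mulrA -Im_as_Re.
Qed.

Lemma cexp0 l : cexp l 0 = 1.
Proof.
rewrite -(cvgC_limC (cvgC_cexp l 0)); apply: cvgC_limC.
have partial n : (0 < n)%N ->
    \sum_(k < n) (0 ^+ k / k`!%:R)%:C * l ^+ k = 1 :> R[i].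
  case: n => // n _; rewrite big_ord_recl big1 => [|i _].
    by rewrite !expr0 fact0 invr1 !mulr1 addr0.
  by rewrite expr0n/= mul0r mul0r.
split; apply: cvg_near_cst; near=> n; rewrite partial//; near: n;
  exact: nbhs_infty_gt.
Unshelve. all: by end_near. Qed.

(* [|e^{lt}|^2 e^{-2 Re(l) t}] has zero derivative. *)
Lemma cmod_cexp l t : cmod (cexp l t) = expR (complex.Re l * t).
Proof.
set x := complex.Re l.
pose f s := (complex.Re (cexp l s) * complex.Re (cexp l s) +
  complex.Im (cexp l s) * complex.Im (cexp l s)) * expR (- 2 * x * s).
have df (s : R) : is_derive s 1 f 0.
  have [h1 h2] := is_deriveC_cexp l s.
  have h3 := is_derive_fun_comp (is_derive_funMl (- 2 * x) (is_derive_fun_id s))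
    (is_derive_expR (- 2 * x * s)).
  apply: is_derive_eq (is_derive_funM (is_derive_funD
    (is_derive_funM h1 h1) (is_derive_funM h2 h2)) h3) _.
  by rewrite !complexReM !complexImM /x; ring.
have := is_derive_0_is_cst t 0 df.
rewrite /f cexp0 !mulr0 expR0 !mulr1 addr0 => h.
rewrite cmodE -[RHS]ger0_norm ?expR_ge0// -sqrtr_sqr; congr Num.sqrt.
apply: (@mulIf _ (expR (- 2 * x * t))); first by rewrite gt_eqF ?expR_gt0.
rewrite !expr2 h -expRD -expRD -[LHS]expR0; congr expR; ring.
Qed.

End ComplexExponential.

(** * Bounded forms and matrix elements *)

Section MatrixElements.
Variables (R : realType) (N : nat).
Local Notation C := R[i].
Implicit Types (X Y : 'M[C]_N) (u v : 'cV[C]_N) (M : R).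

Lemma adjM m n q (A : 'M[C]_(m, n)) (B : 'M[C]_(n, q)) :
  (A *m B)^t* = B^t* *m A^t*.
Proof. by rewrite trmx_mul map_mxM. Qed.

Lemma adjK m n (A : 'M[C]_(m, n)) : (A^t*)^t* = A.
Proof. by apply/matrixP => i j; rewrite !mxE conjCK. Qed.

Lemma adjZ m n c (A : 'M[C]_(m, n)) : (c *: A)^t* = c^*%R *: A^t*.
Proof. by apply/matrixP => i j; rewrite !mxE rmorphM. Qed.

(** Lagrange's identity: twice the difference of the two sides is a double sum of squares. *)
Lemma cauchy_schwarz_sum (I : finType) (x y : I -> R) :
  (\sum_i x i * y i) ^+ 2 <= (\sum_i x i ^+ 2) * (\sum_i y i ^+ 2).
Proof.
rewrite -subr_ge0 -(@pmulr_rge0 _ 2)//.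
have -> : 2 * ((\sum_i x i ^+ 2) * (\sum_i y i ^+ 2) - (\sum_i x i * y i) ^+ 2) =
    \sum_i \sum_j (x i * y j - x j * y i) ^+ 2.
  have e1 : \sum_i \sum_j x i ^+ 2 * y j ^+ 2 = (\sum_i x i ^+ 2) * (\sum_i y i ^+ 2).
    by rewrite mulr_suml; apply: eq_bigr => i _; rewrite mulr_sumr.
  have e2 : \sum_i \sum_j x j ^+ 2 * y i ^+ 2 = (\sum_i x i ^+ 2) * (\sum_i y i ^+ 2).
    by rewrite exchange_big.
  have e3 : \sum_i \sum_j (x i * y i) * (x j * y j) = (\sum_i x i * y i) ^+ 2.
    by rewrite expr2 mulr_suml; apply: eq_bigr => i _; rewrite mulr_sumr.
  transitivity (\sum_i \sum_j x i ^+ 2 * y j ^+ 2 + \sum_i \sum_j x j ^+ 2 * y i ^+ 2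
      - 2 * \sum_i \sum_j (x i * y i) * (x j * y j)); first by rewrite e1 e2 e3; ring.
  rewrite mulr_sumr -big_split -sumrB; apply: eq_bigr => i _ /=.
  rewrite mulr_sumr -big_split -sumrB; apply: eq_bigr => j _ /=; ring.
by apply: sumr_ge0 => i _; apply: sumr_ge0 => j _; rewrite sqr_ge0.
Qed.

Lemma l2norm_ge0 v : 0 <= l2norm v. Proof. exact: sqrtr_ge0. Qed.

Lemma l2norm_sqr v : l2norm v ^+ 2 = \sum_i cmod (v i 0) ^+ 2.
Proof. by rewrite sqr_sqrtr// sumr_ge0// => i _; rewrite sqr_ge0. Qed.

Lemma l2norm0 : l2norm (0 : 'cV[C]_N) = 0.
Proof.
by rewrite /l2norm big1 ?sqrtr0// => i _; rewrite mxE cmod0 expr0n.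
Qed.

Lemma innerE u v : (u^t* *m v) 0 0 = \sum_i (u i 0)^*%R * v i 0.
Proof. by rewrite mxE; apply: eq_bigr => i _; rewrite !mxE. Qed.

Lemma inner_l2norm v : (v^t* *m v) 0 0 = (l2norm v ^+ 2)%:C.
Proof.
rewrite l2norm_sqr rmorph_sum innerE/=; apply: eq_bigr => i _; exact: conjM_cmod.
Qed.

Lemma sum_cmodM_le (I : finType) (x y : I -> C) :
  \sum_i cmod (x i) * cmod (y i) <=
  Num.sqrt (\sum_i cmod (x i) ^+ 2) * Num.sqrt (\sum_i cmod (y i) ^+ 2).
Proof.
have S0 : 0 <= \sum_i cmod (x i) * cmod (y i).
  by apply: sumr_ge0 => i _; rewrite mulr_ge0 ?cmod_ge0.
rewrite -sqrtrM; last by apply: sumr_ge0 => i _; rewrite sqr_ge0.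
rewrite -[leLHS]ger0_norm// -sqrtr_sqr ler_wsqrtr//.
exact: cauchy_schwarz_sum.
Qed.

Lemma cauchy_schwarz u v : cmod ((u^t* *m v) 0 0) <= l2norm u * l2norm v.
Proof.
rewrite innerE; apply: le_trans (cmod_sum _ _) _.
by under eq_bigr do rewrite cmodM cmod_conj; exact: sum_cmodM_le.
Qed.

(** For [0 <= M] this says that the operator norm of [X] is at most [M]. Phrased through the
    sesquilinear form, it passes to sums, multiples and adjoints without handling a supremum. *)
Definition form_bound X M : Prop :=
  forall u v, cmod ((u^t* *m X *m v) 0 0) <= M * (l2norm u * l2norm v).

(** Test the form on [u = X *m v] and cancel one factor [l2norm (X *m v)]. *)
Lemma form_bound_l2norm X M v : 0 <= M -> form_bound X M ->
  l2norm (X *m v) <= M * l2norm v.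
Proof.
move=> M0 bX; have [->|nz] := eqVneq (l2norm (X *m v)) 0.
  by rewrite mulr_ge0 ?l2norm_ge0.
have h := bX (X *m v) v.
rewrite -mulmxA inner_l2norm cmod_real ger0_norm ?sqr_ge0// in h.
have p : 0 < l2norm (X *m v) by rewrite lt_def nz l2norm_ge0.
by rewrite -(ler_pM2l p) -expr2 mulrCA.
Qed.

Lemma form_bound_le X M M' : M <= M' -> form_bound X M -> form_bound X M'.
Proof.
move=> MM' h u v; apply: le_trans (h u v) _.
by rewrite ler_wpM2r// mulr_ge0 ?l2norm_ge0.
Qed.

Lemma form_boundM X Y M M' : 0 <= M -> 0 <= M' ->
  form_bound X M -> form_bound Y M' -> form_bound (X *m Y) (M * M').
Proof.
move=> M0 M'0 bX bY u v; rewrite mulmxA -mulmxA.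
apply: le_trans (bX u (Y *m v)) _.
rewrite -mulrA ler_wpM2l// [leRHS]mulrCA ler_wpM2l ?l2norm_ge0//.
exact: form_bound_l2norm.
Qed.

Lemma form_boundD X Y M M' :
  form_bound X M -> form_bound Y M' -> form_bound (X + Y) (M + M').
Proof.
move=> bX bY u v; rewrite mulmxDr mulmxDl mxE mulrDl.
by apply: le_trans (cmodD _ _) _; rewrite lerD.
Qed.

Lemma form_boundZ c X M : form_bound X M -> form_bound (c *: X) (cmod c * M).
Proof.
move=> bX u v; rewrite -scalemxAr -scalemxAl mxE cmodM -mulrA.
by rewrite ler_wpM2l ?cmod_ge0.
Qed.

Lemma form_boundN X M : form_bound X M -> form_bound (- X) M.
Proof. by move=> bX u v; rewrite mulmxN mulNmx mxE cmodN. Qed.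

Lemma form_boundB X Y M M' :
  form_bound X M -> form_bound Y M' -> form_bound (X - Y) (M + M').
Proof. by move=> bX bY; exact/form_boundD/form_boundN. Qed.

Lemma form_bound0 : form_bound 0 0.
Proof. by move=> u v; rewrite mulmx0 mul0mx mxE cmod0 mul0r. Qed.

Lemma form_bound_sum (I : finType) (P : pred I) (F : I -> 'M[C]_N) (G : I -> R) :
  (forall i, P i -> form_bound (F i) (G i)) ->
  form_bound (\sum_(i | P i) F i) (\sum_(i | P i) G i).
Proof.
move=> h; elim/big_ind2 : _ => [|X1 M1 X2 M2 h1 h2|//].
  exact: form_bound0.
exact: form_boundD.
Qed.

Lemma form_bound_adj X M : form_bound X M -> form_bound (X^t*) M.
Proof.
move=> bX u v; have := bX v u; rewrite -(cmod_conj ((v^t* *m _ *m _) 0 0)).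
have -> : ((v^t* *m X *m u) 0 0)^*%R = (v^t* *m X *m u)^t* 0 0 by rewrite !mxE.
by rewrite !adjM adjK mulmxA (mulrC (l2norm v)).
Qed.

(** The Frobenius norm bounds the set whose supremum is [opnorm], so that [sup] does not fall back
    on its default; it also disposes of vectors of norm zero. *)
Lemma l2norm_mulmx_frobenius X v :
  l2norm (X *m v) <= Num.sqrt (\sum_i \sum_j cmod (X i j) ^+ 2) * l2norm v.
Proof.
rewrite /l2norm -sqrtrM; last first.
  by apply: sumr_ge0 => i _; apply: sumr_ge0 => j _; rewrite sqr_ge0.
rewrite ler_wsqrtr// mulr_suml; apply: ler_sum => i _.
apply: le_trans (cauchy_schwarz_sum (fun j => cmod (X i j)) (fun j => cmod (v j 0))).
rewrite ler_sqr ?nnegrE ?cmod_ge0//; last first.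
  by apply: sumr_ge0 => j _; rewrite mulr_ge0 ?cmod_ge0.
rewrite mxE; apply: le_trans (cmod_sum _ _) _.
by under eq_bigr do rewrite cmodM.
Qed.

Lemma opnorm_has_ubound X :
  has_ubound [set l2norm (X *m v) | v in [set v | l2norm v <= 1]].
Proof.
exists (Num.sqrt (\sum_i \sum_j cmod (X i j) ^+ 2)) => _ [v /= v1 <-].
apply: le_trans (l2norm_mulmx_frobenius X v) _.
by rewrite -[leRHS]mulr1 ler_wpM2l// sqrtr_ge0.
Qed.

Lemma opnorm_ub X v : l2norm v <= 1 -> l2norm (X *m v) <= opnorm X.
Proof.
by move=> v1; apply: sup_upper_bound;
  [split; [exists (l2norm (X *m v)); exists v|exact: opnorm_has_ubound]|exists v].
Qed.

Lemma opnorm_ge0 X : 0 <= opnorm X.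
Proof.
apply: le_trans (@opnorm_ub X 0 _); first exact: l2norm_ge0.
by rewrite l2norm0.
Qed.

Lemma l2normZ c v : l2norm (c *: v) = cmod c * l2norm v.
Proof.
rewrite -[RHS]ger0_norm ?mulr_ge0 ?cmod_ge0 ?l2norm_ge0// -sqrtr_sqr.
rewrite exprMn l2norm_sqr mulr_sumr /l2norm; congr Num.sqrt.
by apply: eq_bigr => i _; rewrite mxE cmodM exprMn.
Qed.

Lemma l2norm_mulmx_le X v : l2norm (X *m v) <= opnorm X * l2norm v.
Proof.
have [v0|nz] := eqVneq (l2norm v) 0.
  by apply: le_trans (l2norm_mulmx_frobenius X v) _; rewrite v0 !mulr0.
have p : 0 < l2norm v by rewrite lt_def nz l2norm_ge0.
have c0 : cmod (l2norm v)^-1%:C = (l2norm v)^-1.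
  by rewrite cmod_real ger0_norm// invr_ge0 ltW.
have := @opnorm_ub X ((l2norm v)^-1%:C *: v).
rewrite l2normZ c0 mulVf// lexx => /(_ isT).
by rewrite -scalemxAr l2normZ c0 mulrC ler_pdivrMr.
Qed.

Lemma form_bound_opnorm X : form_bound X (opnorm X).
Proof.
move=> u v; rewrite -mulmxA; apply: le_trans (cauchy_schwarz _ _) _.
by rewrite mulrCA ler_wpM2l ?l2norm_ge0// l2norm_mulmx_le.
Qed.

End MatrixElements.

(** * Diagonal and off-diagonal parts in an orthonormal basis *)

Section OrthonormalBasis.
Variables (R : realType) (N : nat) (e : 'I_N -> 'cV[R[i]]_N).
Hypothesis he : orthonormal_basis e.
Local Notation C := R[i].
Implicit Types (X Y : 'M[C]_N) (u v : 'cV[C]_N) (x y : 'I_N -> C).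

Definition mel X m n : C := ((e m)^t* *m X *m e n) 0 0.

Definition diagC x : 'M[C]_N := \sum_n x n *: (e n *m (e n)^t*).

Definition offdiag X : 'M[C]_N :=
  \sum_m \sum_(n | m != n) mel X m n *: (e m *m (e n)^t*).

Definition l1off X : R := \sum_m \sum_(n | m != n) cmod (mel X m n).

Lemma diag_opE a : diag_op e a = diagC (fun n => (a n)%:C). Proof. by []. Qed.

Lemma l2norm_basis n : l2norm (e n) = 1.
Proof.
have /(congr1 (@complex.Re R)) := inner_l2norm (e n).
rewrite he eqxx/= => /esym/eqP; rewrite sqrf_eq1 => /orP[/eqP//|/eqP h].
by have := l2norm_ge0 (e n); rewrite h ler0N1.
Qed.

Lemma inner_basis m n : (e m)^t* *m e n = (m == n)%:R%:M.
Proof. by rewrite [LHS]mx11_scalar he. Qed.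

Lemma inner_basis_neq m n : m != n -> (e m)^t* *m e n = 0.
Proof. by move=> /negPf mn; rewrite inner_basis mn raddf0. Qed.

(** Orthonormality says that the matrix [U] with columns [e j] has [U^t*] as a left inverse; for a
    square matrix this is also a right inverse, and [U *m U^t*] is the sum of projectors. *)
Lemma basis_resolution : \sum_n e n *m (e n)^t* = 1%:M.
Proof.
pose U : 'M[C]_N := \matrix_(i, j) e j i 0.
have UU : U^t* *m U = 1%:M.
  apply/matrixP => i j; rewrite [RHS]mxE -he !mxE; apply: eq_bigr => k _.
  by rewrite !mxE.
rewrite -(mulmx1C UU); apply/matrixP => i j.
rewrite summxE mxE; apply: eq_bigr => k _.
by rewrite !mxE big_ord1 !mxE.
Qed.

Lemma mel_sum X : X = \sum_m \sum_n mel X m n *: (e m *m (e n)^t*).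
Proof.
rewrite -[LHS]mul1mx -[LHS]mulmx1 -basis_resolution !mulmx_suml.
apply: eq_bigr => m _; rewrite mulmx_sumr; apply: eq_bigr => n _.
rewrite -!mulmxA (mulmxA X) (mulmxA _ (X *m e n)) (mulmxA _ X).
by rewrite [_ *m X *m _]mx11_scalar -/(mel X m n) mul_scalar_mx -scalemxAr.
Qed.

Lemma diag_offdiag X : X = diagC (fun n => mel X n n) + offdiag X.
Proof.
rewrite {1}(mel_sum X) /diagC /offdiag -big_split; apply: eq_bigr => m _ /=.
rewrite (bigD1 m)//=; congr (_ + _); by apply: eq_bigl => n; rewrite eq_sym.
Qed.

Lemma diagC_M x y : diagC x *m diagC y = diagC (fun n => x n * y n).
Proof.
rewrite /diagC mulmx_suml; apply: eq_bigr => m _.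
rewrite mulmx_sumr (bigD1 m)//= big1 => [|n nm].
  rewrite addr0 -scalemxAl -scalemxAr scalerA -!mulmxA (mulmxA _ (e m)).
  by rewrite inner_basis eqxx mul1mx.
rewrite -scalemxAl -scalemxAr -!mulmxA (mulmxA _ (e n)).
by rewrite inner_basis_neq 1?eq_sym// mul0mx mulmx0 !scaler0.
Qed.

Lemma diagC_comm x y : diagC x *m diagC y = diagC y *m diagC x.
Proof. by rewrite !diagC_M; congr diagC; apply/funext => n; rewrite mulrC. Qed.

Lemma mel_diagC x m n : mel (diagC x) m n = (m == n)%:R * x n.
Proof.
rewrite /mel /diagC mulmx_sumr mulmx_suml (bigD1 n)//= big1 => [|k kn].
  rewrite addr0 -scalemxAr -scalemxAl mulmxA inner_basis -mulmxA inner_basis eqxx.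
  by rewrite mulmx1 !mxE mulrC eqxx mulr1n.
by rewrite -scalemxAr -scalemxAl -!mulmxA inner_basis_neq// !mulmx0 scaler0.
Qed.

Lemma mxtrace_rank1 X u v : \tr (u *m v^t* *m X) = (v^t* *m X *m u) 0 0.
Proof. by rewrite -mulmxA mxtrace_mulC trace_mx11. Qed.

Lemma mxtrace_diagC x X : \tr (diagC x *m X) = \sum_n x n * mel X n n.
Proof.
rewrite /diagC mulmx_suml raddf_sum; apply: eq_bigr => n _ /=.
by rewrite -scalemxAl mxtraceZ mxtrace_rank1.
Qed.

Lemma parseval v : \sum_n cmod (((e n)^t* *m v) 0 0) ^+ 2 = l2norm v ^+ 2.
Proof.
apply: complexI; rewrite -inner_l2norm rmorph_sum.
have -> : v^t* *m v = v^t* *m (1%:M *m v) by rewrite mul1mx.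
rewrite -basis_resolution.
rewrite mulmx_suml mulmx_sumr summxE; apply: eq_bigr => n _ /=.
have -> : v^t* *m (e n *m (e n)^t* *m v) = ((e n)^t* *m v)^t* *m ((e n)^t* *m v).
  by rewrite adjM adjK !mulmxA.
by rewrite [RHS]innerE big_ord1 -conjM_cmod.
Qed.

(** Cauchy-Schwarz on the coordinates, then Parseval. Consequently the diagonal part of an operator
    inherits any bound of the operator. *)
Lemma form_bound_diagC x M : 0 <= M -> (forall n, cmod (x n) <= M) ->
  form_bound (diagC x) M.
Proof.
move=> M0 xM u v; rewrite /diagC mulmx_sumr mulmx_suml summxE.
apply: le_trans (cmod_sum _ _) _.
have -> : l2norm u * l2norm v =
    Num.sqrt (\sum_n cmod (((e n)^t* *m u) 0 0) ^+ 2) *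
    Num.sqrt (\sum_n cmod (((e n)^t* *m v) 0 0) ^+ 2).
  by rewrite !parseval !sqrtr_sqr !ger0_norm ?l2norm_ge0.
apply: le_trans (ler_wpM2l M0 (sum_cmodM_le _ _)).
rewrite mulr_sumr; apply: ler_sum => n _.
have -> : u^t* *m (x n *: (e n *m (e n)^t*)) *m v =
    x n *: (((e n)^t* *m u)^t* *m ((e n)^t* *m v)).
  by rewrite -scalemxAr -scalemxAl adjM adjK !mulmxA.
by rewrite mxE (innerE (_ *m u)) big_ord1 !cmodM cmod_conj ler_wpM2r// mulr_ge0 ?cmod_ge0.
Qed.

Lemma cmod_mel_le X M m n : form_bound X M -> cmod (mel X m n) <= M.
Proof. by move=> bX; have := bX (e m) (e n); rewrite !l2norm_basis !mulr1. Qed.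

(** A Hölder inequality: the trace pairs the off-diagonal elements of [X] with elements of [Y], each
    of modulus at most [M] because basis vectors have norm 1. *)
Lemma cmod_tr_offdiag X Y M : form_bound Y M ->
  cmod (\tr (offdiag X *m Y)) <= l1off X * M.
Proof.
move=> bY; rewrite /offdiag /l1off mulmx_suml raddf_sum mulr_suml.
apply: le_trans (cmod_sum _ _) _; apply: ler_sum => m _ /=.
rewrite mulmx_suml raddf_sum mulr_suml.
apply: le_trans (cmod_sum _ _) _; apply: ler_sum => n _ /=.
rewrite -scalemxAl mxtraceZ mxtrace_rank1 cmodM ler_wpM2l ?cmod_ge0//.
exact: cmod_mel_le.
Qed.

Lemma mel_adj X m n : mel (X^t*) m n = (mel X n m)^*%R.
Proof.
rewrite /mel; have -> : (((e n)^t* *m X *m e m) 0 0)^*%R = ((e n)^t* *m X *m e m)^t* 0 0.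
  by rewrite !mxE.
by rewrite !adjM adjK mulmxA.
Qed.

Lemma mel_mul3 X Y x m n : mel (X *m diagC x *m Y) m n =
  \sum_k mel X m k * x k * mel Y k n.
Proof.
rewrite /mel /diagC mulmx_sumr mulmx_suml mulmx_sumr mulmx_suml summxE.
apply: eq_bigr => k _.
rewrite -scalemxAr -scalemxAl -scalemxAr -scalemxAl mxE mulrAC mulrC.
have -> : (e m)^t* *m (X *m (e k *m (e k)^t*) *m Y) *m e n =
    ((e m)^t* *m X *m e k) *m ((e k)^t* *m Y *m e n) by rewrite !mulmxA.
by congr (_ * _); rewrite mxE big_ord1.
Qed.

End OrthonormalBasis.

(** * Heisenberg evolution *)

(* [lindblad_adj] with ['i], [2^-1] and [(L k)^t*] replaced by arbitrary [ci], [h]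
   and [La k] over a commutative ring. *)
Section AbstractGenerator.
Variables (F : comNzRingType) (N : nat) (K : finType) (ci h : F).
Variables (H : 'M[F]_N) (L La : K -> 'M[F]_N).
Implicit Types X Y : 'M[F]_N.

Definition gksl X : 'M[F]_N :=
  ci *: (H *m X - X *m H) +
  \sum_k (La k *m X *m L k - h *: (La k *m L k *m X + X *m (La k *m L k))).

Lemma gksl_linear : linear gksl.
Proof.
move=> c X Y; rewrite /gksl !mulmxDr !mulmxDl -!scalemxAr -!scalemxAl.
rewrite [in RHS]scalerDr scaler_sumr addrACA -big_split/=; congr (_ + _).
  move: (H *m X) (H *m Y) (X *m H) (Y *m H) => HX HY XH YH.
  by apply/matrixP => i j; rewrite !mxE; ring.
apply: eq_bigr => k _; rewrite !mulmxDr !mulmxDl -!scalemxAr -!scalemxAl.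
move: (La k *m X *m L k) (La k *m Y *m L k) (_ *m L k *m X)
  (_ *m L k *m Y) (X *m _) (Y *m _).
by move=> *; apply/matrixP => i j; rewrite !mxE; ring.
Qed.

Lemma gkslD : {morph gksl : X Y / X + Y}.
Proof. by move=> X Y; rewrite -{1}[X]scale1r gksl_linear scale1r. Qed.

End AbstractGenerator.

Section Generator.
Variables (R : realType) (N : nat) (K : finType).
Local Notation C := R[i].
Variables (H : 'M[C]_N) (L : K -> 'M[C]_N).
Implicit Types (X Y B rho : 'M[C]_N).
Local Notation Ladj := (lindblad_adj H L).

Lemma lindblad_adj_linear : linear Ladj.
Proof. exact: gksl_linear. Qed.

HB.instance Definition _ :=
  GRing.isLinear.Build C 'M[C]_N 'M[C]_N *:%R Ladj lindblad_adj_linear.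

Lemma mxtrace_lindblad B rho : \tr (B *m lindblad H L rho) = \tr (Ladj B *m rho).
Proof.
rewrite /lindblad /lindblad_adj mulmxDr mulmxDl !mxtraceD; congr (_ + _).
  rewrite -scalemxAr -scalemxAl !mxtraceZ /comm mulmxBr mulmxBl !raddfB/=.
  by rewrite !mulmxA [\tr (B *m rho *m H)]mxtrace_mulC mulmxA; ring.
rewrite mulmx_sumr mulmx_suml !raddf_sum; apply: eq_bigr => k _ /=.
rewrite mulmxBr mulmxBl !raddfB/= -scalemxAr -scalemxAl !mxtraceZ /acomm.
rewrite mulmxDr mulmxDl !mxtraceD !mulmxA.
congr (_ - _ * _).
  by rewrite mxtrace_mulC !mulmxA.
rewrite addrC; congr (_ + _).
by rewrite -(mulmxA (B *m rho) _ (L k)) mxtrace_mulC !mulmxA.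
Qed.

Lemma mxtrace_iter_lindblad B rho k :
  \tr (B *m iter k (lindblad H L) rho) = \tr (iter k Ladj B *m rho).
Proof.
elim: k B => [//|k IH] B; by rewrite iterS mxtrace_lindblad IH iterSr.
Qed.

Section Eigenbasis.
Variables (V : (N * N).-tuple 'M[C]_N) (lam : (N * N).-tuple C).
Hypothesis hV : adj_eigenbasis H L V lam.

(** Closed form of the Heisenberg evolution, identified with the exponential series in [expS_Ladj].
    As a finite sum of scalar exponentials it can be differentiated mode by mode. *)
Definition heis X (t : R) : 'M[C]_N :=
  \sum_j (coord V j X * cexp lam`_j t) *: V`_j.

Lemma eigen_decomposition X : X = \sum_j coord V j X *: V`_j.
Proof. by case: hV => hb _ _ _ _; apply: (coord_basis hb); rewrite memvf. Qed.

Lemma Ladj_eigen (j : 'I_(N * N)) : Ladj V`_j = lam`_j *: V`_j.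
Proof. by case: hV => _ hl _ _ _; exact: hl. Qed.

Lemma iter_Ladj X k :
  iter k Ladj X = \sum_j (coord V j X * lam`_j ^+ k) *: V`_j.
Proof.
elim: k => [|k IH].
  by rewrite {1}[X]eigen_decomposition; apply: eq_bigr => j _; rewrite mulr1.
rewrite iterS IH linear_sum; apply: eq_bigr => j _ /=.
by rewrite linearZ/= Ladj_eigen scalerA -mulrA -exprSr.
Qed.

(** Testing against [Y] covers two uses: a matrix unit gives entrywise convergence, and a state
    gives the dual evolution. *)
Lemma exp_series_heis X t Y : cvgC (fun n =>
    \tr ((\sum_(k < n) (t ^+ k / k`!%:R)%:C *: iter k Ladj X) *m Y))
  (\tr (heis X t *m Y)).
Proof.
have -> : \tr (heis X t *m Y) =
    \sum_j (coord V j X * \tr (V`_j *m Y)) * cexp lam`_j t.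
  rewrite /heis mulmx_suml raddf_sum; apply: eq_bigr => j _ /=.
  by rewrite -scalemxAl mxtraceZ; ring.
rewrite (_ : (fun n => _) = fun n => \sum_j (coord V j X * \tr (V`_j *m Y)) *
    \sum_(k < n) (t ^+ k / k`!%:R)%:C * lam`_j ^+ k).
  by apply: cvgC_sum => j; exact/cvgC_Ml/cvgC_cexp.
apply/funext => n; under [in RHS]eq_bigr do rewrite mulr_sumr.
rewrite exchange_big mulmx_suml raddf_sum; apply: eq_bigr => k _ /=.
rewrite iter_Ladj -scalemxAl mxtraceZ mulmx_suml raddf_sum mulr_sumr.
by apply: eq_bigr => j _ /=; rewrite -scalemxAl mxtraceZ; ring.
Qed.

Lemma mxtrace_mul_delta X i j : \tr (X *m delta_mx j i) = X i j.
Proof.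
rewrite /mxtrace (bigD1 i)//= mxE (bigD1 j)//= mxE !eqxx mulr1 !big1 ?addr0//.
  move=> k ki; rewrite mxE big1// => l _; rewrite mxE (negPf ki) andbF mulr0//.
by move=> k kj; rewrite mxE (negPf kj) mulr0.
Qed.

Lemma expS_Ladj X t : expS Ladj t X = heis X t.
Proof.
apply/matrixP => i j; rewrite mxE; apply: cvgC_limC.
have := exp_series_heis X t (delta_mx j i); rewrite mxtrace_mul_delta.
by under eq_fun do rewrite mxtrace_mul_delta.
Qed.

Lemma heis_linear t : linear (heis^~ t).
Proof.
move=> c X Y; rewrite /heis scaler_sumr -big_split; apply: eq_bigr => j _ /=.
by rewrite linearP/= mulrDl scalerDl scalerA mulrA.
Qed.

(** The eigenbasis diagonalizes the adjoint generator, not [lindblad]. Each entry of the series in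
    [lindblad] is therefore written as a trace against a matrix unit and moved to the adjoint side,
    where convergence is known; linearity in [B] does the rest. *)
Lemma mxtrace_expS_lindblad B rho t :
  \tr (B *m expS (lindblad H L) t rho) = \tr (heis B t *m rho).
Proof.
have entry i j : expS (lindblad H L) t rho i j = \tr (heis (delta_mx j i) t *m rho).
  rewrite mxE; apply: cvgC_limC.
  have := exp_series_heis (delta_mx j i) t rho.
  congr (cvgC _ _); apply/funext => n.
  rewrite -[RHS]mxtrace_mul_delta [RHS]mxtrace_mulC mulmx_sumr mulmx_suml !raddf_sum.
  apply: eq_bigr => k _ /=.
  by rewrite -scalemxAr -scalemxAl !mxtraceZ mxtrace_iter_lindblad.
pose h : {linear 'M[C]_N -> 'M[C]_N} :=
  HB.pack (heis^~ t) (GRing.isLinear.Build _ _ _ _ _ (heis_linear t)).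
have -> : heis B t = \sum_i \sum_j B i j *: heis (delta_mx i j) t.
  rewrite {1}[B]matrix_sum_delta -[LHS]/(h _) linear_sum; apply: eq_bigr => i _.
  by rewrite linear_sum; apply: eq_bigr => j _; rewrite linearZ.
rewrite mulmx_suml raddf_sum; apply: eq_bigr => i _ /=.
rewrite mulmx_suml raddf_sum mxE; apply: eq_bigr => j _ /=.
by rewrite -scalemxAl mxtraceZ entry.
Qed.

Lemma heis0 X : heis X 0 = X.
Proof.
rewrite /heis [RHS]eigen_decomposition; apply: eq_bigr => j _.
by rewrite cexp0 mulr1.
Qed.

(** The decaying modes. The omitted index 0 carries the identity operator, hence only a scalar
    matrix. *)
Definition heis_rest X (t : R) : 'M[C]_N :=
  \sum_(j < N * N | (0 < j)%N) (coord V j X * cexp lam`_j t) *: V`_j.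

Lemma heis_split X t : exists c, heis X t = c%:M + heis_rest X t.
Proof.
rewrite /heis /heis_rest (bigID (fun j : 'I_(N * N) => (0 < j)%N))/= addrC.
case: hV => _ _ _ V0 _.
suff [c cE] : exists c, \sum_(j < N * N | ~~ (0 < j)%N)
  (coord V j X * cexp lam`_j t) *: V`_j = c%:M by exists c; rewrite cE.
exists (\sum_(j < N * N | ~~ (0 < j)%N) (coord V j X * cexp lam`_j t)).
rewrite (raddf_sum (@scalar_mx C N)); apply: eq_bigr => j.
by rewrite -eqn0Ngt => /eqP ->; rewrite V0 scalemx1.
Qed.

(** Each [V]_j[has operator norm 1, and for]t >= 0[the modulus]expR (Re lam[_j * t)] is largest for
    the slowest mode, [j = 1]. *)
Lemma heis_rest_bound X t : 0 <= t ->
  form_bound (heis_rest X t) (expR (- gap lam * t) * star_norm V X).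
Proof.
move=> t0; rewrite /star_norm mulr_sumr; apply: form_bound_sum => j j0.
case: hV => _ _ V1 _ [_ _ lam_le].
have := form_boundZ (coord V j X * cexp lam`_j t) (@form_bound_opnorm _ _ V`_j).
rewrite V1// mulr1 cmodM cmod_cexp; apply: form_bound_le.
rewrite mulrC ler_wpM2r ?cmod_ge0// ler_expR ler_wpM2r//.
by rewrite /gap opprK lam_le.
Qed.

End Eigenbasis.
End Generator.

(** * The antisymmetric correlator and its off-diagonal bound *)

Lemma mxtraceB (F : pzRingType) (n : nat) (A B : 'M[F]_n) :
  \tr (A - B) = \tr A - \tr B.
Proof. exact: raddfB. Qed.

Section Asymmetry.
Variables (F : comNzRingType) (N : nat) (D : 'M[F]_N -> 'M[F]_N) (pi : 'M[F]_N).
Hypotheses (DD : {morph D : X Y / X + Y}) (D1 : forall c, D c%:M = 0)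
  (Dpi : forall X, \tr (D X *m pi) = 0).
Implicit Types X Y : 'M[F]_N.

(** The form [T] of the overview, for an arbitrary map [D] in place of the adjoint generator. *)
Definition asym X Y : F := \tr (D X *m Y *m pi) - \tr (X *m D Y *m pi).

(** [D1] removes a scalar standing inside [D]; [Dpi] removes one standing outside. *)
Lemma asym_scalar_add X Y c d : asym (c%:M + X) (d%:M + Y) = asym X Y.
Proof.
rewrite /asym !DD !D1 !add0r mulmxDr mulmxDl [(_ + X) *m _]mulmxDl mulmxDl !mxtraceD.
rewrite mul_mx_scalar mul_scalar_mx -!scalemxAl !mxtraceZ.
by rewrite !Dpi !mulr0 !add0r.
Qed.

Lemma asymDl X X' Y : asym (X + X') Y = asym X Y + asym X' Y.
Proof. by rewrite /asym DD !mulmxDl !mxtraceD; ring. Qed.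

Lemma asymDr X Y Y' : asym X (Y + Y') = asym X Y + asym X Y'.
Proof. by rewrite /asym DD !mulmxDr !mulmxDl !mxtraceD; ring. Qed.

(** Three terms instead of four: [Yo] is paired with the whole of [X], so each off-diagonal part is
    charged only once. *)
Lemma asym_split X Xd Xo Y Yd Yo : X = Xd + Xo -> Y = Yd + Yo ->
  asym X Y = asym Xd Yd + asym Xo Yd + asym X Yo.
Proof. by move=> eX ->; rewrite asymDr {1}eX asymDl. Qed.

End Asymmetry.

Lemma mulr2_sub_add (F : pzRingType) (t : F) : t - 2 * t + t = 0.
Proof. by rewrite mulr_natl mulr2n opprD addrA subrr add0r addNr. Qed.

Section GeneratorAsymmetry.
Variables (F : comNzRingType) (N : nat) (K : finType) (ci h : F).
Variables (H : 'M[F]_N) (L La : K -> 'M[F]_N) (pi : 'M[F]_N).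
Implicit Types X Y : 'M[F]_N.
Local Notation gksl := (gksl ci h H L La).

(* The terms with [L^* L] between [X] and [Y] cancel. *)
Lemma gksl_asymE X Y : asym gksl pi X Y =
  ci * (\tr (H *m X *m Y *m pi) - 2 * \tr (X *m H *m Y *m pi)
        + \tr (X *m Y *m H *m pi)) +
  \sum_k (\tr (La k *m X *m L k *m Y *m pi)
          - \tr (X *m La k *m Y *m L k *m pi)
          - h * (\tr (La k *m L k *m X *m Y *m pi)
                    - \tr (X *m Y *m La k *m L k *m pi))).
Proof.
rewrite /asym /gksl mulmxDr !mulmxDl !mxtraceD opprD addrACA.
congr (_ + _).
  rewrite -scalemxAr -!scalemxAl !mxtraceZ mulmxBr !mulmxBl !mxtraceB.
  by rewrite !mulmxA; ring.
rewrite mulmx_sumr !mulmx_suml !(raddf_sum (@mxtrace F N)) -sumrB; apply: eq_bigr => k _ /=.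
rewrite mulmxBr !mulmxBl !mxtraceB -scalemxAr -!scalemxAl !mxtraceZ.
rewrite mulmxDr !mulmxDl !mxtraceD !mulmxA.
by ring.
Qed.

(** What multiplies [X] once cyclicity of the trace has brought [X] to the front of [asym X Y];
    [gksl_dual_r] does the same for [Y]. An off-diagonal argument is thus traced against a single
    operator. *)
Definition gksl_dual_l Y : 'M[F]_N :=
  ci *: (Y *m pi *m H - (2 : F) *: (H *m Y *m pi) + Y *m H *m pi) +
  \sum_k (L k *m Y *m pi *m La k - La k *m Y *m L k *m pi
    - h *: (Y *m pi *m La k *m L k - Y *m La k *m L k *m pi)).

Definition gksl_dual_r X : 'M[F]_N :=
  ci *: (pi *m H *m X - (2 : F) *: (pi *m X *m H) + H *m pi *m X) +
  \sum_k (pi *m La k *m X *m L k - L k *m pi *m X *m La k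
    - h *: (pi *m La k *m L k *m X - La k *m L k *m pi *m X)).

Lemma gksl_asym_left X Y : asym gksl pi X Y = \tr (X *m gksl_dual_l Y).
Proof.
rewrite gksl_asymE /gksl_dual_l mulmxDr mxtraceD; congr (_ + _).
  rewrite -scalemxAr mxtraceZ !mulmxDr mulmxN -scalemxAr !mxtraceD.
  rewrite raddfN/= mxtraceZ !mulmxA [\tr (X *m Y *m pi *m H)]mxtrace_mulC.
  by rewrite !mulmxA.
rewrite mulmx_sumr raddf_sum; apply: eq_bigr => k _ /=.
rewrite !mulmxBr -scalemxAr mulmxBr !mxtraceB mxtraceZ mxtraceB !mulmxA.
rewrite [\tr (X *m L k *m Y *m pi *m La k)]mxtrace_mulC.
rewrite -(mulmxA (X *m Y *m pi)) [\tr (X *m Y *m pi *m _)]mxtrace_mulC.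
by rewrite !mulmxA.
Qed.

Lemma gksl_asym_right X Y : asym gksl pi X Y = \tr (Y *m gksl_dual_r X).
Proof.
rewrite gksl_asymE /gksl_dual_r mulmxDr mxtraceD; congr (_ + _).
  rewrite -scalemxAr mxtraceZ !mulmxDr mulmxN -scalemxAr !mxtraceD.
  rewrite raddfN/= mxtraceZ !mulmxA.
  rewrite -(mulmxA (Y *m pi)) [\tr (Y *m pi *m (H *m X))]mxtrace_mulC.
  rewrite -(mulmxA (Y *m pi)) [\tr (Y *m pi *m (X *m H))]mxtrace_mulC.
  by rewrite [\tr (Y *m H *m pi *m X)]mxtrace_mulC !mulmxA.
rewrite mulmx_sumr raddf_sum; apply: eq_bigr => k _ /=.
rewrite !mulmxBr -scalemxAr mulmxBr !mxtraceB mxtraceZ mxtraceB !mulmxA.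
have e1 : \tr (Y *m pi *m La k *m X *m L k) =
    \tr (La k *m X *m L k *m Y *m pi).
  by rewrite -!mulmxA mulmxA mxtrace_mulC !mulmxA.
have e2 : \tr (Y *m L k *m pi *m X *m La k) =
    \tr (X *m La k *m Y *m L k *m pi).
  by rewrite -(mulmxA (Y *m L k *m pi)) mxtrace_mulC !mulmxA.
have e3 : \tr (Y *m pi *m La k *m L k *m X) =
    \tr (La k *m L k *m X *m Y *m pi).
  by rewrite -!mulmxA mulmxA mxtrace_mulC !mulmxA.
have e4 : \tr (Y *m La k *m L k *m pi *m X) =
    \tr (X *m Y *m La k *m L k *m pi).
  by rewrite mxtrace_mulC !mulmxA.
by rewrite e1 e2 e3 e4.
Qed.

(** By commutation and cyclicity the three Hamiltonian traces coincide and cancel as [1 - 2 + 1],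
    and the two traces weighted by [h] coincide as well. Only the jump terms survive. *)
Lemma gksl_asym_commuting X Y :
  X *m Y = Y *m X -> X *m pi = pi *m X -> Y *m pi = pi *m Y ->
  asym gksl pi X Y =
  \sum_k (\tr (La k *m X *m L k *m Y *m pi) - \tr (X *m La k *m Y *m L k *m pi)).
Proof.
move=> XY Xpi Ypi; rewrite gksl_asymE.
have e1 : \tr (X *m H *m Y *m pi) = \tr (H *m X *m Y *m pi).
  by rewrite -!mulmxA [LHS]mxtrace_mulC -!mulmxA -Xpi (mulmxA Y) -XY -!mulmxA.
have XYpi : pi *m (X *m Y) = X *m (Y *m pi) by rewrite mulmxA -Xpi -mulmxA -Ypi.
have e2 : \tr (X *m Y *m H *m pi) = \tr (H *m X *m Y *m pi).
  by rewrite -(mulmxA _ H) [LHS]mxtrace_mulC -!mulmxA XYpi.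
rewrite e1 e2 mulr2_sub_add mulr0 add0r; apply: eq_bigr => k _.
have -> : \tr (X *m Y *m La k *m L k *m pi) = \tr (La k *m L k *m X *m Y *m pi).
  rewrite -(mulmxA _ _ (L k)) -(mulmxA (X *m Y)) [LHS]mxtrace_mulC -!mulmxA.
  by rewrite XYpi.
by rewrite subrr mulr0 subr0.
Qed.

End GeneratorAsymmetry.

Section Commutator.
Variables (R : realType) (N : nat) (K : finType).
Local Notation C := R[i].
Variables (H : 'M[C]_N) (L : K -> 'M[C]_N) (pi : 'M[C]_N).
Hypothesis hss : lindblad H L pi = 0.
Implicit Types (X Y : 'M[C]_N) (c : C).
Local Notation Ladj := (lindblad_adj H L).

Local Notation asym := (asym Ladj pi).

Lemma LadjD X Y : Ladj (X + Y) = Ladj X + Ladj Y.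
Proof. exact: gkslD. Qed.

Lemma Ladj1 c : Ladj c%:M = 0.
Proof.
rewrite /lindblad_adj /comm mul_mx_scalar mul_scalar_mx subrr scaler0 add0r.
rewrite big1// => k _; rewrite /acomm mul_mx_scalar -scalemxAl.
rewrite mul_mx_scalar mul_scalar_mx; move: (_ *m _) => A.
by apply/matrixP => i j; rewrite !mxE; field.
Qed.

Lemma mxtrace_Ladj_stationary X : \tr (Ladj X *m pi) = 0.
Proof. by rewrite -mxtrace_lindblad hss mulmx0 raddf0. Qed.

Definition asym_dual_l Y : 'M[C]_N :=
  'i *: (Y *m pi *m H - (2 : C) *: (H *m Y *m pi) + Y *m H *m pi) +
  \sum_k (L k *m Y *m pi *m (L k)^t* - (L k)^t* *m Y *m L k *m pi
    - 2^-1 *: (Y *m pi *m (L k)^t* *m L k - Y *m (L k)^t* *m L k *m pi)).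

Definition asym_dual_r X : 'M[C]_N :=
  'i *: (pi *m H *m X - (2 : C) *: (pi *m X *m H) + H *m pi *m X) +
  \sum_k (pi *m (L k)^t* *m X *m L k - L k *m pi *m X *m (L k)^t*
    - 2^-1 *: (pi *m (L k)^t* *m L k *m X - (L k)^t* *m L k *m pi *m X)).

Lemma asym_left X Y : asym X Y = \tr (X *m asym_dual_l Y).
Proof. exact: gksl_asym_left. Qed.

Lemma asym_right X Y : asym X Y = \tr (Y *m asym_dual_r X).
Proof. exact: gksl_asym_right. Qed.

Hypothesis pi_bound : form_bound pi 1.

Lemma cmod2 : cmod (2 : C) = 2.
Proof. by rewrite -(rmorph_nat (real_complex R)) cmod_real ger0_norm. Qed.

Lemma cmod2V : cmod (2^-1 : C) = 2^-1.
Proof.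
apply: (@mulfI _ 2); first by rewrite pnatr_eq0.
by rewrite -{1}cmod2 -cmodM !divff ?cmod1// pnatr_eq0.
Qed.

Ltac form_bound_product := repeat match goal with
  | |- is_true (0 <= 1) => exact: ler01
  | |- is_true (0 <= opnorm _) => exact: opnorm_ge0
  | |- is_true (0 <= _ * _) => apply: mulr_ge0
  | |- is_true (0 <= _) => assumption
  | |- form_bound (_ *m _) _ => apply: form_boundM
  | |- form_bound (map_mx _ _) _ => apply: form_bound_adj
  | |- form_bound ?A (opnorm ?A) => exact: form_bound_opnorm
  | |- form_bound _ _ => assumption
  end.

(** This count produces [Theta]: the Hamiltonian terms weigh [1 + 2 + 1 = 4], and those of each jump
    operator weigh [1 + 1 + (1 + 1) / 2 = 3], while [pi] has bound 1. *)
Lemma form_bound_dual_l Y M : 0 <= M -> form_bound Y M ->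
  form_bound (asym_dual_l Y) (Theta H L * M).
Proof.
move=> M0 bY.
have eqH : Theta H L * M =
    cmod ('i : C) * ((M * 1 * opnorm H) +
      cmod (2 : C) * (opnorm H * M * 1) + (M * opnorm H * 1)) +
    \sum_k ((opnorm (L k) * M * 1 * opnorm (L k)) + (opnorm (L k) * M * opnorm (L k) * 1)
      + cmod (2^-1 : C) * (M * 1 * opnorm (L k) * opnorm (L k)
        + M * opnorm (L k) * opnorm (L k) * 1)).
  rewrite cmod_i cmod2 cmod2V /Theta mulrDl; congr (_ + _); first by ring.
  by rewrite mulr_sumr mulr_suml; apply: eq_bigr => k _; field.
rewrite eqH /asym_dual_l; apply: form_boundD.
  apply/form_boundZ/form_boundD; last first.
    by form_bound_product.
  apply: form_boundB; first by form_bound_product.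
  apply: form_boundZ.
  by form_bound_product.
apply: form_bound_sum => k _; apply: form_boundB.
  apply: form_boundB.
    by form_bound_product.
  by form_bound_product.
apply/form_boundZ/form_boundB.
  by form_bound_product.
by form_bound_product.
Qed.

Lemma form_bound_dual_r X M : 0 <= M -> form_bound X M ->
  form_bound (asym_dual_r X) (Theta H L * M).
Proof.
move=> M0 bX.
have eqH : Theta H L * M =
    cmod ('i : C) * ((1 * opnorm H * M) +
      cmod (2 : C) * (1 * M * opnorm H) + (opnorm H * 1 * M)) +
    \sum_k ((1 * opnorm (L k) * M * opnorm (L k)) + (opnorm (L k) * 1 * M * opnorm (L k))
      + cmod (2^-1 : C) * (1 * opnorm (L k) * opnorm (L k) * M
        + opnorm (L k) * opnorm (L k) * 1 * M)).
  rewrite cmod_i cmod2 cmod2V /Theta mulrDl; congr (_ + _); first by ring.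
  by rewrite mulr_sumr mulr_suml; apply: eq_bigr => k _; field.
rewrite eqH /asym_dual_r; apply: form_boundD.
  apply/form_boundZ/form_boundD; last first.
    by form_bound_product.
  apply: form_boundB; first by form_bound_product.
  apply: form_boundZ.
  by form_bound_product.
apply: form_bound_sum => k _; apply: form_boundB.
  apply: form_boundB.
    by form_bound_product.
  by form_bound_product.
apply/form_boundZ/form_boundB.
  by form_bound_product.
by form_bound_product.
Qed.

End Commutator.

(** * Diagonal part: the classical jump process *)

Section DiagonalPart.
Variables (R : realType) (N : nat) (K : finType).
Local Notation C := R[i].
Variables (H : 'M[C]_N) (L : K -> 'M[C]_N) (pi : 'M[C]_N).
Variables (dual : K -> K) (ds : K -> R) (e : 'I_N -> 'cV[C]_N) (p : 'I_N -> R).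
Hypotheses (hldb : local_detailed_balance L dual ds)
  (hpi : density_matrix pi) (hss : lindblad H L pi = 0)
  (he : orthonormal_basis e) (hpi_spec : pi = diag_op e p).
Implicit Types (x y : 'I_N -> C).
Local Notation asym := (asym (lindblad_adj H L) pi).
Local Notation jump := (K * 'I_N * 'I_N)%type.

Lemma diagC1 : diagC e (fun=> 1) = 1%:M.
Proof.
by rewrite /diagC; under eq_bigr do rewrite scale1r; exact: basis_resolution.
Qed.

Lemma population_ge0 n : 0 <= p n.
Proof.
have [_ /(_ (e n)) + _] := hpi.
by rewrite hpi_spec diag_opE -/(mel e _ n n) mel_diagC// eqxx mul1r ler0c.
Qed.

Lemma sum_population : \sum_n p n = 1.
Proof.
have [_ _] := hpi; rewrite -[pi]mulmx1 hpi_spec diag_opE mxtrace_diagC//.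
move=> /(congr1 (@complex.Re R)); rewrite Re_sum/= => <-; apply: eq_bigr => n _.
by rewrite /mel mulmx1 he eqxx mulr1.
Qed.

Lemma form_bound_pi : form_bound pi 1.
Proof.
rewrite hpi_spec diag_opE; apply: form_bound_diagC => // n.
rewrite cmod_real ger0_norm ?population_ge0// -sum_population (bigD1 n)//= lerDl.
by apply: sumr_ge0 => m _; exact: population_ge0.
Qed.

(* The flux of the jump [L_k] from [|n>] to [|m>]. *)
Definition flux (i : jump) : R := cmod (mel e (L i.1.1) i.1.2 i.2) ^+ 2 * p i.2.

Lemma flux_ge0 i : 0 <= flux i.
Proof. by rewrite mulr_ge0 ?sqr_ge0 ?population_ge0. Qed.

Lemma sum_jump (V : nmodType) (G : jump -> V) :
  \sum_i G i = \sum_k \sum_m \sum_n G (k, m, n).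
Proof. by rewrite !pair_bigA; apply: eq_bigr => -[[k m] n]. Qed.

Lemma mxtrace_jump k x y :
  \tr (diagC e y *m ((L k)^t* *m diagC e x *m L k)) =
  \sum_m \sum_n (cmod (mel e (L k) m n) ^+ 2)%:C * x m * y n.
Proof.
rewrite mxtrace_diagC// exchange_big; apply: eq_bigr => n _.
rewrite mel_mul3 mulr_sumr; apply: eq_bigr => m _.
by rewrite mel_adj -conjM_cmod; ring.
Qed.

(** Operators diagonal in the eigenbasis of [pi] commute with it and with each other, so only jump
    terms remain; they expand into classical transitions. *)
Lemma asym_diagC x y : asym (diagC e x) (diagC e y) =
  \sum_i (flux i)%:C * (x i.1.2 * y i.2 - x i.2 * y i.1.2).
Proof.
have piE : pi = diagC e (fun n => (p n)%:C) by rewrite hpi_spec diag_opE.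
rewrite [LHS](@gksl_asym_commuting _ _ _ _ _ H L (fun k => (L k)^t*)); first last.
- by rewrite piE diagC_comm.
- by rewrite piE diagC_comm.
- exact: diagC_comm.
rewrite sum_jump; apply: eq_bigr => k _.
set X := diagC e x; set Y := diagC e y.
have e4 : \tr ((L k)^t* *m X *m L k *m Y *m pi) =
    \tr (diagC e (fun n => y n * (p n)%:C) *m ((L k)^t* *m X *m L k)).
  by rewrite -(diagC_M he y (fun n => (p n)%:C)) -piE  -(mulmxA _ Y pi) [LHS]mxtrace_mulC.
have e5 : \tr (X *m (L k)^t* *m Y *m L k *m pi) =
    \tr (diagC e (fun n => (p n)%:C * x n) *m ((L k)^t* *m Y *m L k)).
  by rewrite -(diagC_M he (fun n => (p n)%:C) x) -piE [LHS]mxtrace_mulC !mulmxA.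
rewrite e4 e5 !mxtrace_jump -sumrB; apply: eq_bigr => m _.
rewrite -sumrB; apply: eq_bigr => n _.
by rewrite /flux/= rmorphM/=; ring.
Qed.

(* Global balance, tested against an arbitrary observable [x]. *)
Lemma sum_flux_gradient (x : 'I_N -> R) :
  \sum_i flux i * (x i.1.2 - x i.2) = 0.
Proof.
apply: complexI; have := asym_diagC (fun n => (x n)%:C) (fun=> 1).
rewrite diagC1 /asym Ladj1 mulmx0 mul0mx raddf0 mulmx1.
rewrite (mxtrace_Ladj_stationary hss) subr0 => h.
rewrite rmorph0 [RHS]h rmorph_sum; apply: eq_bigr => i _.
by rewrite !mulr1 rmorphM rmorphB.
Qed.

(** Test global balance on the indicator of the unpopulated states. Nothing flows out of them, so
    the total flux into them, a sum of nonnegative terms, is zero. *)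
Lemma flux_eq0 i : p i.1.2 = 0 -> flux i = 0.
Proof.
have := sum_flux_gradient (fun n => (p n == 0)%:R).
have termE j : flux j * ((p j.1.2 == 0)%:R - (p j.2 == 0)%:R) =
    flux j * (p j.1.2 == 0)%:R.
  by rewrite /flux; case: (eqVneq (p j.2) 0) => [->|_]; rewrite ?subr0// !mulr0 !mul0r.
under eq_bigr do rewrite termE.
move=> /psumr_eq0P h p0.
have := h (fun j _ => mulr_ge0 (flux_ge0 j) (ler0n _ _)) i isT.
by rewrite p0 eqxx mulr1.
Qed.

Definition reversal (i : jump) : jump := (dual i.1.1, i.2, i.1.2).

(** Log-ratio of a flux to its reverse. Where a population vanishes [ln] takes a default value,
    harmlessly: both fluxes are then zero. *)
Definition affinity (i : jump) : R := ds i.1.1 + (ln (p i.2) - ln (p i.1.2)).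

Lemma reversalK : involutive reversal.
Proof. by case: hldb => dK _ _ [[k m] n]; rewrite /reversal/= dK. Qed.

Lemma affinityN i : affinity (reversal i) = - affinity i.
Proof. by case: hldb => _ _ dsN; rewrite /affinity/= dsN; ring. Qed.

(** Local detailed balance contributes [expR (ds k)] through the squared matrix elements; the
    logarithms contribute the ratio of populations. *)
Lemma flux_reversal i : flux i = expR (affinity i) * flux (reversal i).
Proof.
case: i => [[k m] n]; rewrite /affinity /reversal /=.
have [pm0|pm] := eqVneq (p m) 0.
  by rewrite flux_eq0// /flux/= pm0 !mulr0.
have [pn0|pn] := eqVneq (p n) 0.
  by rewrite [flux (_, n, m)]flux_eq0// /flux/= pn0 !mulr0.
have pn1 : 0 < p n by rewrite lt_def pn population_ge0.
have pm1 : 0 < p m by rewrite lt_def pm population_ge0.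
case: hldb => _ LE _.
rewrite /flux/= expRD expRB !lnK ?posrE//.
have -> : cmod (mel e (L k) m n) ^+ 2 = expR (ds k) * cmod (mel e (L (dual k)) n m) ^+ 2.
  have -> : mel e (L k) m n =
      (expR (ds k / 2))%:C * (mel e (L (dual k)) n m)^*%R.
    by rewrite -mel_adj {1}LE /mel -scalemxAr -scalemxAl mxE.
  rewrite cmodM cmod_conj exprMn cmod_real ger0_norm ?expR_ge0//.
  suff -> : expR (ds k / 2) ^+ 2 = expR (ds k) by [].
  by rewrite -expRM_natl; congr expR; field.
by field.
Qed.

Lemma Re_mxtrace_jump k : complex.Re (\tr (L k *m pi *m (L k)^t*)) =
  \sum_m \sum_n flux (k, m, n).
Proof.
have -> : \tr (L k *m pi *m (L k)^t*) =
    \tr (pi *m ((L k)^t* *m diagC e (fun=> 1) *m L k)).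
  by rewrite diagC1 mulmx1 -mulmxA mxtrace_mulC -!mulmxA.
rewrite hpi_spec diag_opE mxtrace_jump Re_sum; apply: eq_bigr => m _.
rewrite Re_sum; apply: eq_bigr => n _.
by rewrite mulr1 complexReM/= mul0r subr0.
Qed.

Lemma dynamical_activityE : dynamical_activity L pi = \sum_i flux i.
Proof.
by rewrite sum_jump; apply: eq_bigr => k _; rewrite Re_mxtrace_jump.
Qed.

(** The population part of the affinity is a gradient, and averages to zero by global balance tested
    on [ln p]. *)
Lemma entropy_productionE :
  entropy_production L ds pi = \sum_i flux i * affinity i.
Proof.
have := sum_flux_gradient (fun n => ln (p n)) => h.
transitivity (\sum_i flux i * ds i.1.1).
  rewrite sum_jump; apply: eq_bigr => k _; rewrite Re_mxtrace_jump mulr_suml.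
  by apply: eq_bigr => m _; rewrite mulr_suml.
rewrite -[LHS]subr0 -[X in _ - X]h -sumrB; apply: eq_bigr => i _.
by rewrite /affinity; ring.
Qed.

(** The weight [z] is odd under reversal, so twice the sum pairs [z] with net fluxes. The factor 2
    from this symmetrization cancels the one in [cmod (z i) <= 2 * (Mx * My)]. *)
Lemma cmod_asym_diagC x y (Mx My : R) :
  0 <= Mx -> 0 <= My -> (forall n, cmod (x n) <= Mx) -> (forall n, cmod (y n) <= My) ->
  cmod (asym (diagC e x) (diagC e y)) <=
  Mx * My * thermo_term (entropy_production L ds pi) (dynamical_activity L pi).
Proof.
move=> Mx0 My0 hx hy; rewrite asym_diagC.
pose z (i : jump) := x i.1.2 * y i.2 - x i.2 * y i.1.2.
have zN i : z (reversal i) = - z i by rewrite /z/=; ring.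
have zM i : cmod (z i) <= 2 * (Mx * My).
  apply: le_trans (cmodB _ _) _; rewrite !cmodM mulr_natl mulr2n.
  by apply: lerD; apply: ler_pM; rewrite ?cmod_ge0.
set S := \sum_i _.
have S2 : S *+ 2 = \sum_i (flux i - flux (reversal i))%:C * z i.
  have -> : S *+ 2 = S + \sum_i (flux (reversal i))%:C * z (reversal i).
    by rewrite (sum_involution reversalK (fun i => (flux i)%:C * z i)).
  rewrite -big_split; apply: eq_bigr => i _.
  by rewrite /= zN rmorphB/= /z; ring.
have : cmod (S *+ 2) <= 2 * (Mx * My) * \sum_i `|flux i - flux (reversal i)|.
  rewrite S2; apply: le_trans (cmod_sum _ _) _; rewrite mulr_sumr.
  apply: ler_sum => i _; rewrite cmodM cmod_real mulrC.
  by rewrite ler_wpM2r.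
rewrite -mulr_natl cmodM cmod2 -mulrA ler_pM2l// => /le_trans; apply.
rewrite ler_wpM2l ?mulr_ge0// dynamical_activityE entropy_productionE.
apply: flux_le_thermo_term.
- exact: reversalK.
- exact: flux_ge0.
- exact: flux_reversal.
- exact: affinityN.
Qed.

End DiagonalPart.

(** * Integration along the interpolation *)

Section IntegralBound.
Variable R : realType.
Local Notation mu := (@lebesgue_measure R).

Lemma continuous_integrable01 (f : R -> R) : continuous f ->
  mu.-integrable `[0%R, 1%R] (EFin \o f).
Proof.
move=> cf; apply: continuous_compact_integrable; first exact: segment_compact.
exact: continuous_subspaceT.
Qed.

(** The fundamental theorem of calculus followed by monotonicity of the integral; [d] equals its own
    integral since the interval has length 1. *)
Lemma increment_le_integral (phi dphi G : R -> R) (c d : R) :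
  (forall s : R, is_derive s 1 phi (dphi s)) -> continuous dphi -> continuous G ->
  (forall s, 0 <= s <= 1 -> dphi s <= c * G s + d) ->
  phi 1 - phi 0 <= c * (\int[mu]_(s in `[0%R, 1%R]) G s) + d.
Proof.
move=> hd cd cG hle.
have cphi : continuous phi by move=> s; exact: is_derive_continuous (hd s).
have FTC : (\int[mu]_(s in `[0%R, 1%R]) (dphi s)%:E = (phi 1)%:E - (phi 0)%:E)%E.
  apply: continuous_FTC2 => //; first exact: continuous_subspaceT.
    split => [s _||]; first by have [] := hd s.
      exact: cvg_at_right_filter (cphi 0).
    exact: cvg_at_left_filter (cphi 1).
  by move=> s _; rewrite derive1E; have [_ ->] := hd s.
have -> : phi 1 - phi 0 = \int[mu]_(s in `[0%R, 1%R]) dphi s.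
  by rewrite /Rintegral FTC.
have cont_cG : continuous (fun s => c * G s).
  by move=> s; apply: cvgMr; exact: cG.
have -> : c * (\int[mu]_(s in `[0%R, 1%R]) G s) + d =
    \int[mu]_(s in `[0%R, 1%R]) (c * G s + d).
  rewrite RintegralD//; first last.
  - by apply: continuous_integrable01; exact: cst_continuous.
  - exact: continuous_integrable01.
  rewrite RintegralZl//; last exact: continuous_integrable01.
  rewrite Rintegral_cst//= lebesgue_measure_itv/= lte_fin ltr01.
  by rewrite oppr0 addr0 mulr1.
apply: le_Rintegral => //.
- exact: continuous_integrable01.
- apply: continuous_integrable01 => s; apply: cvgD; first exact: cont_cG.
  exact: cvg_cst.
Qed.

End IntegralBound.

Section BilinearTrace.
Variables (F : comNzRingType) (N : nat) (I : finType).
Variables (W : I -> 'M[F]_N) (pi : 'M[F]_N).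

Lemma mxtrace_bilinear (x y : I -> F) :
  \tr ((\sum_j x j *: W j) *m (\sum_k y k *: W k) *m pi) =
  \sum_j \sum_k x j * y k * \tr (W j *m W k *m pi).
Proof.
rewrite !mulmx_suml raddf_sum; apply: eq_bigr => j _.
rewrite mulmx_sumr mulmx_suml raddf_sum; apply: eq_bigr => k _ /=.
by rewrite -scalemxAl -scalemxAr -!scalemxAl !mxtraceZ mulrA.
Qed.

Lemma asym_bilinear (D : 'M[F]_N -> 'M[F]_N) (l x y : I -> F) :
  D (\sum_j x j *: W j) = \sum_j (x j * l j) *: W j ->
  D (\sum_j y j *: W j) = \sum_j (y j * l j) *: W j ->
  asym D pi (\sum_j x j *: W j) (\sum_j y j *: W j) =
  \sum_j \sum_k (l j - l k) * (x j * y k * \tr (W j *m W k *m pi)).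
Proof.
move=> Dx Dy; rewrite /asym Dx Dy !mxtrace_bilinear -sumrB; apply: eq_bigr => j _.
by rewrite -sumrB; apply: eq_bigr => k _; ring.
Qed.

End BilinearTrace.

(** * The interpolating function in the eigenbasis *)

Section Evolution.
Variables (R : realType) (N : nat) (K : finType).
Local Notation C := R[i].
Variables (H : 'M[C]_N) (L : K -> 'M[C]_N) (pi : 'M[C]_N).
Variables (V : (N * N).-tuple 'M[C]_N) (lam : (N * N).-tuple C).
Hypotheses (hss : lindblad H L pi = 0) (hV : adj_eigenbasis H L V lam).
Variables (e : 'I_N -> 'cV[C]_N).
Hypothesis he : orthonormal_basis e.
Implicit Types X Y A B : 'M[C]_N.
Local Notation Ladj := (lindblad_adj H L).
Local Notation heis := (heis V lam).
Local Notation heis_rest := (heis_rest V lam).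

Lemma mel_heis X t m n : mel e (heis X t) m n =
  \sum_j (coord V j X * mel e V`_j m n) * cexp lam`_j t.
Proof.
rewrite /mel /heis mulmx_sumr mulmx_suml summxE; apply: eq_bigr => j _.
by rewrite -scalemxAr -scalemxAl mxE mulrAC.
Qed.

Lemma continuous_cmod (f : R -> C) (df : R -> C) :
  (forall t, is_deriveC f t (df t)) -> continuous (fun t => cmod (f t)).
Proof.
move=> hf; under eq_fun do rewrite cmodE.
move=> t; have [h1 h2] := hf t.
apply: (@continuous_comp _ _ _ (fun t => complex.Re (f t) ^+ 2 + complex.Im (f t) ^+ 2)
  (@Num.sqrt R)); last exact: sqrt_continuous.
have c1 := is_derive_continuous h1; have c2 := is_derive_continuous h2.
by apply: cvgD; rewrite !expr2; apply: cvgM.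
Qed.

Lemma continuous_sum (I : finType) (P : pred I) (f : I -> R -> R) :
  (forall i, P i -> continuous (f i)) -> continuous (fun t => \sum_(i | P i) f i t).
Proof.
move=> h t; apply: cvg_big => [|i Pi]; first exact: add_continuous.
exact: h.
Qed.

Lemma coherenceE g X t : coherence H L e g X t = expR (g * t) * l1off e (heis X t).
Proof. by rewrite /coherence (expS_Ladj hV). Qed.

(** Makes the integrand of [coherence_term] continuous, hence integrable. *)
Lemma continuous_coherence g X : continuous (coherence H L e g X).
Proof.
have -> : coherence H L e g X = fun t => expR (g * t) * l1off e (heis X t).
  by apply/funext => t; exact: coherenceE.
move=> t; apply: cvgM.
  exact: is_derive_continuous
    (is_derive_fun_comp (is_derive_funMl g (is_derive_fun_id t)) (is_derive_expR _)).
apply: continuous_sum => m _; apply: continuous_sum => n _.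
apply: (@continuous_cmod _
  (fun t => \sum_j (coord V j X * mel e V`_j m n) * (lam`_j * cexp lam`_j t))) => s.
under eq_fun do rewrite mel_heis.
by apply: is_deriveC_sum => j; exact/is_deriveC_Ml/is_deriveC_cexp.
Qed.

Lemma Ladj_heis X t :
  Ladj (heis X t) = \sum_j (coord V j X * cexp lam`_j t * lam`_j) *: V`_j.
Proof.
rewrite /heis linear_sum; apply: eq_bigr => j _ /=.
by rewrite linearZ/= (Ladj_eigen hV) scalerA.
Qed.

Lemma l1off_heis X t : l1off e (heis X t) = l1off e (heis_rest X t).
Proof.
have [c ->] := heis_split hV X t.
apply: eq_bigr => m _; apply: eq_bigr => n mn; congr cmod.
rewrite /mel mulmxDr mulmxDl mxE mul_mx_scalar -scalemxAl.
by rewrite inner_basis_neq// scaler0 mxE add0r.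
Qed.

Variable tau : R.

(** Expansion of the interpolation over pairs of modes. Differentiating only multiplies the
    coefficients by [tau * (lam]_j - lam[_k)], so derivatives keep this shape. *)
Definition two_time (c : 'I_(N * N) -> 'I_(N * N) -> C) (s : R) : C :=
  \sum_j \sum_k c j k * (cexp lam`_j (s * tau) * cexp lam`_k ((1 - s) * tau)).

Lemma is_deriveC_two_time c s : is_deriveC (two_time c) s
  (two_time (fun j k => tau%:C * (lam`_j - lam`_k) * c j k) s).
Proof.
apply: is_deriveC_sum => j; apply: is_deriveC_sum => k.
have d1 : is_derive s 1 (fun t : R => t * tau) tau.
  apply: is_derive_eq (is_derive_funM (is_derive_fun_id s) (is_derive_fun_cst s tau)) _.
  by rewrite mul1r mulr0 addr0.
have d2 : is_derive s 1 (fun t : R => (1 - t) * tau) (- tau).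
  apply: is_derive_eq (is_derive_funM (is_derive_funB (is_derive_fun_cst s 1)
    (is_derive_fun_id s)) (is_derive_fun_cst s tau)) _.
  by rewrite sub0r mulN1r mulr0 addr0.
have h := is_deriveC_Ml (c j k) (is_deriveC_M
  (is_deriveC_comp d1 (is_deriveC_cexp lam`_j _))
  (is_deriveC_comp d2 (is_deriveC_cexp lam`_k _))).
congr (is_deriveC _ _ _): h.
by rewrite rmorphN; ring.
Qed.

Definition corr_coef B A (j k : 'I_(N * N)) : C :=
  coord V j B * coord V k A * \tr (V`_j *m V`_k *m pi).

Lemma mxtrace_two_time B A s :
  \tr (heis B (s * tau) *m heis A ((1 - s) * tau) *m pi) = two_time (corr_coef B A) s.
Proof.
rewrite /heis mxtrace_bilinear; apply: eq_bigr => j _; apply: eq_bigr => k _.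
by rewrite /corr_coef; ring.
Qed.

Lemma asym_two_time B A s :
  tau%:C * asym Ladj pi (heis B (s * tau)) (heis A ((1 - s) * tau)) =
  two_time (fun j k => tau%:C * (lam`_j - lam`_k) * corr_coef B A j k) s.
Proof.
rewrite [asym _ _ _ _](asym_bilinear _ (Ladj_heis B _) (Ladj_heis A _)).
rewrite mulr_sumr; apply: eq_bigr => j _; rewrite mulr_sumr; apply: eq_bigr => k _.
by rewrite /corr_coef; ring.
Qed.

End Evolution.

(** * Bound on the derivative of the interpolation *)

Section AsymmetryBound.
Variables (R : realType) (N : nat) (K : finType).
Local Notation C := R[i].
Variables (H : 'M[C]_N) (L : K -> 'M[C]_N) (pi : 'M[C]_N).
Variables (dual : K -> K) (ds : K -> R) (e : 'I_N -> 'cV[C]_N) (p : 'I_N -> R).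
Hypotheses (hldb : local_detailed_balance L dual ds)
  (hpi : density_matrix pi) (hss : lindblad H L pi = 0)
  (he : orthonormal_basis e) (hpi_spec : pi = diag_op e p).
Variables (V : (N * N).-tuple 'M[C]_N) (lam : (N * N).-tuple C).
Hypothesis hV : adj_eigenbasis H L V lam.
Implicit Types X Y A B : 'M[C]_N.
Local Notation Ladj := (lindblad_adj H L).
Local Notation sigma := (entropy_production L ds pi).
Local Notation gamma := (dynamical_activity L pi).

Lemma star_norm_ge0 X : 0 <= star_norm V X.
Proof. by apply: sumr_ge0 => k _; exact: cmod_ge0. Qed.

(** The three terms of [asym_split]: the classical estimate for the diagonal pair, then the dual
    operators for the off-diagonal parts of [X] and of [Y]. *)
Lemma cmod_asym_le X Y (MX MY : R) : 0 <= MX -> 0 <= MY ->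
  form_bound X MX -> form_bound Y MY ->
  cmod (asym Ladj pi X Y) <=
  MX * MY * thermo_term sigma gamma +
  l1off e X * (Theta H L * MY) + l1off e Y * (Theta H L * MX).
Proof.
move=> MX0 MY0 bX bY.
have bpi := form_bound_pi hpi he hpi_spec.
have xM n : cmod (mel e X n n) <= MX by exact: cmod_mel_le.
have yM n : cmod (mel e Y n n) <= MY by exact: cmod_mel_le.
have bYd := form_bound_diagC he MY0 yM.
rewrite (asym_split pi (LadjD H L) (diag_offdiag he X) (diag_offdiag he Y)).
apply: le_trans (cmodD _ _) _; apply: lerD.
  apply: le_trans (cmodD _ _) _; apply: lerD.
    exact: (cmod_asym_diagC hldb hpi hss he hpi_spec).
  rewrite asym_left; apply: cmod_tr_offdiag => //.
  exact: form_bound_dual_l.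
rewrite asym_right; apply: cmod_tr_offdiag => //.
exact: form_bound_dual_r.
Qed.

Lemma cmod_asym_heis_le A B (tau s : R) : 0 <= tau -> 0 <= s <= 1 ->
  cmod (asym Ladj pi (heis V lam B (s * tau)) (heis V lam A ((1 - s) * tau))) <=
  expR (- gap lam * tau) *
  (Theta H L * (star_norm V B * coherence H L e (gap lam) A ((1 - s) * tau) +
                star_norm V A * coherence H L e (gap lam) B (s * tau)) +
   star_norm V A * star_norm V B * thermo_term sigma gamma).
Proof.
move=> tau0 /andP[s0 s1].
have t1 : 0 <= s * tau by rewrite mulr_ge0.
have t2 : 0 <= (1 - s) * tau by rewrite mulr_ge0// subr_ge0.
rewrite !(coherenceE hV) !(l1off_heis hV he).
have [c ->] := heis_split hV B (s * tau).
have [d ->] := heis_split hV A ((1 - s) * tau).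
rewrite (asym_scalar_add (LadjD H L) (Ladj1 H L) (mxtrace_Ladj_stationary hss)).
have bB := heis_rest_bound hV B t1; have bA := heis_rest_bound hV A t2.
set g := gap lam in bA bB *.
have SA := star_norm_ge0 A; have SB := star_norm_ge0 B.
have MB0 : 0 <= expR (- g * (s * tau)) * star_norm V B.
  by rewrite mulr_ge0 ?expR_ge0.
have MA0 : 0 <= expR (- g * ((1 - s) * tau)) * star_norm V A.
  by rewrite mulr_ge0 ?expR_ge0.
apply: le_trans (cmod_asym_le MB0 MA0 bB bA) _.
have eAB : expR (- g * tau) = expR (- g * (s * tau)) * expR (- g * ((1 - s) * tau)).
  by rewrite -expRD; congr expR; ring.
have eV t : expR (- g * t) * expR (g * t) = 1.
  by rewrite -expRD mulNr addNr expR0.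
(* In the off-diagonal terms only one argument supplies a decay factor; the prefactor [expR (g * t)]
   built into [coherence] compensates for the other. *)
have eA : expR (- g * tau) * expR (g * ((1 - s) * tau)) = expR (- g * (s * tau)).
  by rewrite eAB -mulrA eV mulr1.
have eB : expR (- g * tau) * expR (g * (s * tau)) = expR (- g * ((1 - s) * tau)).
  by rewrite eAB mulrAC eV mul1r.
set lA := l1off e (heis_rest V lam A _); set lB := l1off e (heis_rest V lam B _).
set T := thermo_term _ _.
have -> : expR (- g * tau) *
  (Theta H L * (star_norm V B * (expR (g * ((1 - s) * tau)) * lA) +
     star_norm V A * (expR (g * (s * tau)) * lB)) +
   star_norm V A * star_norm V B * T) =
  (expR (- g * tau) * expR (g * ((1 - s) * tau))) * Theta H L * star_norm V B * lA +
  (expR (- g * tau) * expR (g * (s * tau))) * Theta H L * star_norm V A * lB +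
  expR (- g * tau) * star_norm V A * star_norm V B * T by ring.
rewrite eA eB eAB le_eqVlt; apply/orP; left; apply/eqP; ring.
Qed.

End AsymmetryBound.

Theorem mainTheorem2 (R : realType) (N : nat) (hN : (2 <= N)%N)
    (K : finType) (H : 'M[R[i]]_N) (L : K -> 'M[R[i]]_N)
    (hH : H^t* = H)
    (dual : K -> K) (ds : K -> R) (hldb : local_detailed_balance L dual ds)
    (pi : 'M[R[i]]_N) (hpi : density_matrix pi) (hss : lindblad H L pi = 0)
    (e : 'I_N -> 'cV[R[i]]_N) (he : orthonormal_basis e)
    (p : 'I_N -> R) (hpi_spec : pi = diag_op e p)
    (V : (N * N).-tuple 'M[R[i]]_N) (lam : (N * N).-tuple R[i])
    (hV : adj_eigenbasis H L V lam)
    (a b : 'I_N -> R) (tau : R) (htau : 0 <= tau) :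
  let A := diag_op e a in
  let B := diag_op e b in
  let g := gap lam in
  let sigma := entropy_production L ds pi in
  let gamma := dynamical_activity L pi in
  cmod (corr H L pi B A tau - corr H L pi A B tau) <=
    tau * expR (- g * tau) *
    (coherence_term H L e V g A B tau +
     star_norm V A * star_norm V B * thermo_term sigma gamma).
Proof.
cbv zeta; set A := diag_op e a; set B := diag_op e b; set g := gap lam.
set sigma := entropy_production L ds pi; set gamma := dynamical_activity L pi.
pose c := corr_coef pi V B A.
pose f := two_time lam tau c.
pose df := two_time lam tau (fun j k => tau%:C * (lam`_j - lam`_k) * c j k).
have corrBA : corr H L pi B A tau = f 1.
  rewrite /corr (mxtrace_expS_lindblad hV) /f -mxtrace_two_time.
  by rewrite mul1r subrr mul0r (heis0 hV) mulmxA.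
(* At [s = 0] the function is the trace of [B], the evolved [A] and [pi] in this order; commuting
   [B] with [pi] and cycling the trace exchanges the two observables. *)
have corrAB : corr H L pi A B tau = f 0.
  rewrite /corr (mxtrace_expS_lindblad hV) /f -mxtrace_two_time.
  rewrite mul0r subr0 mul1r (heis0 hV).
  have -> : B *m pi = pi *m B by rewrite hpi_spec; exact: diagC_comm.
  by rewrite mulmxA [LHS]mxtrace_mulC mulmxA.
rewrite corrBA corrAB.
(* One phase, fixed for the whole interval, reduces the claim to the real function
   [Re (u * f s)]. *)
have [u u1 uE] := cmod_phase (f 1 - f 0).
pose G s := star_norm V B * coherence H L e g A ((1 - s) * tau) +
  star_norm V A * coherence H L e g B (s * tau).
have dfE s : is_deriveC (fun s => u * f s) s (u * df s).
  exact/is_deriveC_Ml/is_deriveC_two_time.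
(* The second derivative serves to make the first one continuous, as the fundamental theorem of
   calculus requires. *)
have ddfE s : is_deriveC (fun s => u * df s) s (u * two_time lam tau
    (fun j k => tau%:C * (lam`_j - lam`_k) * (tau%:C * (lam`_j - lam`_k) * c j k)) s).
  exact/is_deriveC_Ml/is_deriveC_two_time.
rewrite -uE mulrBr [complex.Re _]raddfB /=.
have -> : tau * expR (- g * tau) * (coherence_term H L e V g A B tau +
     star_norm V A * star_norm V B * thermo_term sigma gamma) =
  tau * expR (- g * tau) * Theta H L * (\int[lebesgue_measure]_(s in `[0%R, 1%R]) G s) +
  tau * expR (- g * tau) * (star_norm V A * star_norm V B * thermo_term sigma gamma).
  by rewrite /coherence_term mulrDr -!mulrA.
apply: (increment_le_integral (phi := fun s => complex.Re (u * f s))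
  (dphi := fun s => complex.Re (u * df s))).
- by move=> s; have [] := dfE s.
- by move=> s; have [h _] := ddfE s; exact: is_derive_continuous h.
- have caff (x y : R) : continuous (fun s : R => (x + y * s) * tau).
    move=> s; apply: cvgMl; apply: cvgD; first exact: cvg_cst.
    by apply: cvgMr; exact: cvg_id.
  move=> s; apply: cvgD; apply: cvgMr.
    have := @continuous_comp _ _ _ (fun s : R => (1 - s) * tau)
      (coherence H L e g A) s.
    apply; last exact: (continuous_coherence hV).
    have := caff 1 (-1) s; by under eq_fun do rewrite mulN1r.
  have := @continuous_comp _ _ _ (fun s : R => s * tau) (coherence H L e g B) s.
  apply; last exact: (continuous_coherence hV).
  by have := caff 0 1 s; under eq_fun do rewrite mul1r add0r.
- move=> s s01; apply: le_trans (Re_le_cmod _) _.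
  rewrite cmodM u1 mul1r /df /c -(asym_two_time pi hV) cmodM cmod_real ger0_norm//.
  apply: le_trans (ler_wpM2l htau (cmod_asym_heis_le
    hldb hpi hss he hpi_spec hV A B htau s01)) _.
  rewrite -/g -/sigma -/gamma -/(G s) le_eqVlt; apply/orP; left; apply/eqP; ring.
Qed.
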